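(* Let $k\in\mathbb{N}$, $n>2k$, and $q^*(k)=\frac{(n+2)k}{n-2k}$. Consider the problem \[ S_k(D^2u)=\lambda(1-u)^{q^*(k)}\ \text{in } B,\qquad u<0\ \text{in } B,\qquad u=0\ \text{on }\partial B, \] and set $\mu^*(k)=\dfrac{\binom{n}{k}\left(\frac{n-2k}{k}\right)^k k^k}{(k+1)^{k+1}}$. \begin{itemize} \item[(i)] If $\lambda\in(0,\mu^*(k))$, the equation $\lambda(d+1)^{k+1}-\binom{n}{k}\left(\frac{n-2k}{k}\right)^k d^k=0$ has exactly two positive roots $d_-(\lambda)<d_+(\lambda)$, and the problem has exactly two radially symmetric solutions, given by \[ u_\lambda(x)=1-\lambda^{-\frac{n-2k}{2k(k+1)}}\big(-w_{d_-(\lambda)}(x)\big),\qquad U_\lambda(x)=1-\lambda^{-\frac{n-2k}{2k(k+1)}}\big(-w_{d_+(\lambda)}(x)\big),\quad x\in B. \] \item[(ii)] If $\lambda=\mu^*(k)$, the problem has a unique radially symmetric solution, given by \[ u^*(x)=1-(\mu^*(k))^{-\frac{n-2k}{2k(k+1)}}\big(-w_k(x)\big)=1-\left(\frac{1+k}{1+k|x|^2}\right)^{\frac{n-2k}{2k}},\quad x\in B. \] \end{itemize}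
   Context: $B$ is the unit ball of $\mathbb{R}^n$; $S_k(D^2u)$ denotes the $k$-th elementary symmetric polynomial of the eigenvalues of the Hessian $D^2u$; solutions are understood in the class $\{u\in C^2(B)\cap C(\overline B): S_i(D^2u)\ge0 \text{ in } B,\ i=1,\dots,k\}$. For $d>0$ the Bliss function $w_d$ is \[ w_d(x)=-\frac{\left[d\binom{n}{k}^{1/k}\left(\frac{n-2k}{k}\right)\right]^{\frac{n-2k}{2(k+1)}}}{(1+d|x|^2)^{\frac{n-2k}{2k}}},\quad x\in\mathbb{R}^n. \] *)

(* Defs.v *)
From Stdlib Require Import Reals Lra ClassicalEpsilon.
Open Scope R_scope.

Fixpoint rsum (m : nat) (f : nat -> R) : R :=
  match m with O => 0 | S p => rsum p f + f p end.

(* Points of R^n are represented as sequences vanishing from index n on. *)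
Definition pt := nat -> R.
Definition in_Rn (n : nat) (x : pt) : Prop := forall i, (n <= i)%nat -> x i = 0.
Definition norm2 (n : nat) (x : pt) : R := rsum n (fun i => x i ^ 2).
Definition dist2 (n : nat) (x y : pt) : R := rsum n (fun i => (x i - y i) ^ 2).
Definition in_ball (n : nat) (x : pt) : Prop := in_Rn n x /\ norm2 n x < 1.
Definition in_cball (n : nat) (x : pt) : Prop := in_Rn n x /\ norm2 n x <= 1.
Definition on_sphere (n : nat) (x : pt) : Prop := in_Rn n x /\ norm2 n x = 1.

Definition shift (i : nat) (t : R) (x : pt) : pt :=
  fun j => if Nat.eqb j i then x j + t else x j.
Definition has_partial (f : pt -> R) (i : nat) (x : pt) (l : R) : Prop :=
  derivable_pt_lim (fun t => f (shift i t x)) 0 l.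

Definition cont_within (n : nat) (S : pt -> Prop) (f : pt -> R) (x : pt) : Prop :=
  forall eps, eps > 0 -> exists delta, delta > 0 /\
    forall y, S y -> dist2 n y x < delta ^ 2 -> Rabs (f y - f x) < eps.

Definition is_C2_on_ball (n : nat) (u : pt -> R)
    (D1 : nat -> pt -> R) (D2 : nat -> nat -> pt -> R) : Prop :=
  forall x, in_ball n x ->
    cont_within n (in_Rn n) u x /\
    forall i, (i < n)%nat ->
      has_partial u i x (D1 i x) /\ cont_within n (in_Rn n) (D1 i) x /\
      forall j, (j < n)%nat ->
        has_partial (D1 i) j x (D2 i j x) /\ cont_within n (in_Rn n) (D2 i j) x.

Fixpoint esym (lam : nat -> R) (m k : nat) : R :=
  match m with
  | O => match k with O => 1 | S _ => 0 end
  | S m' => match k with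
            | O => 1
            | S k' => esym lam m' k + lam m' * esym lam m' k'
            end
  end.

(* spectral decomposition H = Q diag(lam) Q^T with Q orthogonal (n x n);
   lam 0, ..., lam (n-1) are then the eigenvalues of H. *)
Definition orthogonal (n : nat) (Q : nat -> nat -> R) : Prop :=
  forall i j, (i < n)%nat -> (j < n)%nat ->
    rsum n (fun l => Q i l * Q j l) = if Nat.eqb i j then 1 else 0.
Definition eigen_decomp (n : nat) (H Q : nat -> nat -> R) (lam : nat -> R) : Prop :=
  orthogonal n Q /\
  forall i j, (i < n)%nat -> (j < n)%nat ->
    H i j = rsum n (fun l => Q i l * lam l * Q j l).
Definition Sk_spec (n k : nat) (H : nat -> nat -> R) (v : R) : Prop :=
  exists Q lam, eigen_decomp n H Q lam /\ v = esym lam n k.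
Definition Sk (n k : nat) (H : nat -> nat -> R) : R :=
  epsilon (inhabits 0) (fun v => Sk_spec n k H v).

Definition qstar (n k : nat) : R := (INR n + 2) * INR k / (INR n - 2 * INR k).
Definition mustar (n k : nat) : R :=
  C n k * ((INR n - 2 * INR k) / INR k) ^ k * INR k ^ k / (INR k + 1) ^ (k + 1).

Definition is_solution (n k : nat) (lam : R) (u : pt -> R) : Prop :=
  exists D1 D2, is_C2_on_ball n u D1 D2 /\
    (forall x, in_cball n x -> cont_within n (in_cball n) u x) /\
    (forall x, in_ball n x ->
       (forall i, (1 <= i <= k)%nat -> Sk n i (fun a b => D2 a b x) >= 0) /\
       Sk n k (fun a b => D2 a b x) = lam * Rpower (1 - u x) (qstar n k) /\
       u x < 0) /\
    (forall x, on_sphere n x -> u x = 0).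

Definition radial (n : nat) (u : pt -> R) : Prop :=
  forall x y, in_cball n x -> in_cball n y -> norm2 n x = norm2 n y -> u x = u y.

Definition bliss (n k : nat) (d : R) (x : pt) : R :=
  - Rpower (d * Rpower (C n k) (1 / INR k) * ((INR n - 2 * INR k) / INR k))
           ((INR n - 2 * INR k) / (2 * (INR k + 1)))
  / Rpower (1 + d * norm2 n x) ((INR n - 2 * INR k) / (2 * INR k)).

Definition expo (n k : nat) : R := (INR n - 2 * INR k) / (2 * INR k * (INR k + 1)).

Definition sol_from (n k : nat) (lam d : R) (x : pt) : R :=
  1 - Rpower lam (- expo n k) * (- bliss n k d x).

Definition root_eq (n k : nat) (lam d : R) : Prop :=
  lam * (d + 1) ^ (k + 1) - C n k * ((INR n - 2 * INR k) / INR k) ^ k * d ^ k = 0.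

Definition ustar (n k : nat) (x : pt) : R :=
  1 - Rpower ((1 + INR k) / (1 + INR k * norm2 n x)) ((INR n - 2 * INR k) / (2 * INR k)).

(* Main.v *)
Require Import Defs.
From mathcomp Require all_boot all_algebra Rstruct.
From Coquelicot Require Import Coquelicot.
From Stdlib Require Import Reals Lra Lia ClassicalEpsilon FunctionalExtensionality.
Open Scope R_scope.

(* A radial function has Hessian a I + b x x^T, so every S_k is explicit in terms of the
   profile f(r), p = f' and v = 1 - f, and the problem becomes
     (r^(n-k) p^k)' = (n / C(n,k)) lam r^(n-1) v^q.
   Since q is critical, the Pohozaev functional is conserved, and it vanishes at r = 0.
   Substituting it back removes the nonlinearity and leaves
     (r p' - p) v = - (1 + 1/m) r p^2,   m = (n - 2k) / (2k),
   which says that (v^(-1/m))' / r is constant.  Hence v^(-1/m) is affine in r^2, and the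
   boundary condition gives v = ((1 + d) / (1 + d r^2))^m, where the equation forces d to
   solve lam (d+1)^(k+1) = C(n,k) (2m)^k d^k.  The function k ln d - (k+1) ln (d+1)
   increases up to d = k and decreases afterwards, which counts the roots. *)

(** [Sk] chooses among all spectral decompositions, so it can be computed only once every
    decomposition is known to give the same value. The polynomial det(I + X H), which mentions no
    decomposition, settles this. The k-th equation sees only p^k and leaves the sign of p open when
    k is even. The constraint S_1 >= 0 supplies the sign, and p > 0 is what allows the common factor
    to be cancelled after the Pohozaev identity is substituted. The equation involves p / r and is
    singular at the origin. Only quantities continuous at r = 0 (the flux, the Pohozaev functional,
    v^(-1/m)) are carried there, by a mean value theorem that asks for derivatives in the open
    interval alone. No uniqueness theorem for ODEs is used: the two first integrals give the profile
    in closed form, and the Pohozaev identity, evaluated once more at a single radius, yields the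
    equation for d. *)

Module SpectralInvariants.
Import all_boot all_algebra Rstruct GRing.Theory.
Local Open Scope ring_scope.

(** * The value of S_k does not depend on the spectral decomposition *)

Lemma rsum_big (m : nat) (f : nat -> R) : rsum m f = \sum_(i < m) f i.
Proof.
by elim: m => [|m IH] /=; rewrite ?big_ord0 // big_ord_recr /= -IH.
Qed.

(** The recursion of [esym] is the coefficient rule for multiplying by one more factor 1 + lam_m
    X. *)
Lemma esym_coef (lam : nat -> R) (m j : nat) :
  Defs.esym lam m j = (\prod_(i < m) (1 + lam i *: 'X : {poly R}))`_j.
Proof.
elim: m j => [|m IH] j; first by rewrite big_ord0 coef1; case: j.
rewrite big_ord_recr /= mulrDr mulr1 coefD -scalerAr coefZ coefMX.
by case: j => [|j] /=; rewrite -!IH ?mulr0 ?addr0 //; case: (m).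
Qed.

(** Conjugating by [Q] over the polynomial ring diagonalises I + X H. The left side knows only [H],
    hence so does the product on the right. *)
Lemma det_eigen_decomp (n : nat) (H Q : nat -> nat -> R) (lam : nat -> R) :
  eigen_decomp n H Q lam ->
  \det (1%:M + 'X *: map_mx polyC (\matrix_(i < n, j < n) H i j)) =
  \prod_(i < n) (1 + lam i *: 'X : {poly R}).
Proof.
case=> orthQ decH.
pose q := \matrix_(i < n, j < n) Q i j.
pose L := diag_mx (\row_(i < n) lam i).
have qqT : q *m q^T = 1%:M.
  apply/matrixP=> i j; rewrite !mxE.
  have := orthQ i j (elimT ltP (ltn_ord i)) (elimT ltP (ltn_ord j)).
  rewrite rsum_big => orthij.
  under eq_bigr => l _ do rewrite !mxE.
  rewrite {}orthij; case: (Nat.eqb_spec i j) => [/val_inj ->|ne]; first by rewrite eqxx.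
  by case: eqP => [eij|//]; case: ne; rewrite eij.
have HE : \matrix_(i < n, j < n) H i j = q *m L *m q^T.
  apply/matrixP=> i j; rewrite !mxE.
  rewrite (decH i j (elimT ltP (ltn_ord i)) (elimT ltP (ltn_ord j))) rsum_big.
  by apply: eq_bigr => l _; rewrite mul_mx_diag !mxE.
have pqqT : map_mx polyC q *m (map_mx polyC q^T) = 1%:M by rewrite -map_mxM qqT map_mx1.
have -> : 1%:M + 'X *: map_mx polyC (\matrix_(i < n, j < n) H i j)
   = map_mx polyC q *m (1%:M + 'X *: map_mx polyC L) *m map_mx polyC q^T.
  by rewrite HE !map_mxM mulmxDr mulmx1 mulmxDl pqqT -scalemxAr -scalemxAl.
(* Determinants commute, which brings those of q and its transpose together, so the row relation q
   q^T = 1 is enough. *)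
rewrite !det_mulmx mulrAC -det_mulmx pqqT det1 mul1r.
have -> : 1%:M + 'X *: map_mx polyC L = diag_mx (\row_(i < n) (1 + lam i *: 'X)).
  apply/matrixP=> i j; rewrite !mxE -mul_polyC.
  by case: eqP => [->|]; rewrite /= ?mulr1n ?mulr0n ?rmorph0 ?mulr0 ?addr0 // mulrC.
by rewrite det_diag; apply: eq_bigr => i _; rewrite mxE.
Qed.

Lemma Sk_spec_unique (n k : nat) (H : nat -> nat -> R) (v w : R) :
  Sk_spec n k H v -> Sk_spec n k H w -> v = w.
Proof.
move=> [Q [lam [dec ->]]] [Q' [lam' [dec' ->]]].
by rewrite !esym_coef -(det_eigen_decomp _ _ _ _ dec) (det_eigen_decomp _ _ _ _ dec').
Qed.
End SpectralInvariants.

(** The decomposition behind [epsilon] is unknown; uniqueness lets any decomposition at hand compute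
    [Sk]. *)
Lemma Sk_eigen_decomp (n k : nat) (H Q : nat -> nat -> R) (lam : nat -> R) :
  eigen_decomp n H Q lam -> Sk n k H = esym lam n k.
Proof.
  intros dec.
  assert (spec : Sk_spec n k H (esym lam n k)) by (exists Q, lam; auto).
  apply (SpectralInvariants.Sk_spec_unique n k H); [|exact spec].
  unfold Sk. apply epsilon_spec. exists (esym lam n k). exact spec.
Qed.

(** * Finite sums and the spectrum of a I + b x x^T *)

Lemma rsum_ext (m : nat) (f g : nat -> R) :
  (forall i, (i < m)%nat -> f i = g i) -> rsum m f = rsum m g.
Proof.
  induction m as [|m IH]; intros E; simpl; [reflexivity|].
  rewrite IH by (intros; apply E; lia). now rewrite E by lia.
Qed.

Lemma rsum_plus (m : nat) (f g : nat -> R) :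
  rsum m (fun i => f i + g i) = rsum m f + rsum m g.
Proof. induction m as [|m IH]; simpl; [ring|]. rewrite IH. ring. Qed.

Lemma rsum_scal (m : nat) (c : R) (f : nat -> R) :
  rsum m (fun i => c * f i) = c * rsum m f.
Proof. induction m as [|m IH]; simpl; [ring|]. rewrite IH. ring. Qed.

Lemma rsum_0 (m : nat) (f : nat -> R) :
  (forall i, (i < m)%nat -> f i = 0) -> rsum m f = 0.
Proof.
  induction m as [|m IH]; intros E; simpl; [reflexivity|].
  rewrite IH by (intros; apply E; lia). rewrite E by lia. ring.
Qed.

Lemma rsum_nonneg (m : nat) (f : nat -> R) :
  (forall i, (i < m)%nat -> 0 <= f i) -> 0 <= rsum m f.
Proof.
  induction m as [|m IH]; intros E; simpl; [lra|].
  specialize (IH (fun i hi => E i (Nat.lt_lt_succ_r _ _ hi))).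
  specialize (E m (Nat.lt_succ_diag_r m)). lra.
Qed.

Lemma rsum_ge_term (m i : nat) (f : nat -> R) :
  (forall j, (j < m)%nat -> 0 <= f j) -> (i < m)%nat -> f i <= rsum m f.
Proof.
  induction m as [|m IH]; intros E hi; [lia|]. simpl.
  destruct (Nat.eq_dec i m) as [->|ne].
  - assert (0 <= rsum m f) by (apply rsum_nonneg; intros; apply E; lia). lra.
  - assert (f i <= rsum m f) by (apply IH; [intros; apply E; lia|lia]).
    specialize (E m (Nat.lt_succ_diag_r m)). lra.
Qed.

Definition delta (i j : nat) : R := if Nat.eqb i j then 1 else 0.

Lemma delta_sym (i j : nat) : delta i j = delta j i.
Proof. unfold delta. now rewrite Nat.eqb_sym. Qed.

Lemma delta_diag (i : nat) : delta i i = 1.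
Proof. unfold delta. now rewrite Nat.eqb_refl. Qed.

Lemma delta_off (i j : nat) : i <> j -> delta i j = 0.
Proof. intros ne. unfold delta. now rewrite (proj2 (Nat.eqb_neq i j) ne). Qed.

Lemma rsum_delta (m i : nat) (f : nat -> R) :
  (i < m)%nat -> rsum m (fun l => delta i l * f l) = f i.
Proof.
  induction m as [|m IH]; intros hi; [lia|]. simpl.
  destruct (Nat.eq_dec i m) as [->|ne].
  - rewrite rsum_0 by (intros; rewrite delta_off by lia; ring).
    rewrite delta_diag. ring.
  - rewrite IH by lia. rewrite delta_off by lia. ring.
Qed.

(** The spectrum of a I + b x x^T: [a] on the hyperplane orthogonal to x and [p] along x. The
    exceptional eigenvalue sits at the last index, the one that [esym] peels off first. *)
Definition axial (n : nat) (a p : R) (i : nat) : R := a + (p - a) * delta (n - 1) i.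

(* The Householder reflection exchanging the unit vectors [e] and [e_(n-1)]. *)
Lemma orthogonal_last_column (n : nat) (e : nat -> R) :
  (1 <= n)%nat -> rsum n (fun i => e i ^ 2) = 1 ->
  exists Q, orthogonal n Q /\ forall i, (i < n)%nat -> Q i (n - 1)%nat = e i.
Proof.
  intros hn he. set (z := (n - 1)%nat).
  assert (hz : (z < n)%nat) by (unfold z; lia).
  (* When e z = 1 the vector e is the last unit vector, the reflection vector vanishes, and the
     identity serves. *)
  destruct (Req_dec (e z) 1) as [e1|ne1].
  - exists delta. split.
    + intros i j hi hj. rewrite rsum_delta by assumption.
      apply delta_sym.
    + intros i hi. destruct (Nat.eq_dec i z) as [->|ne].
      * now rewrite delta_diag.
      * rewrite delta_off by assumption.
        assert (h : rsum n (fun j => e j ^ 2 - delta z j * e j ^ 2) = 0).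
        { rewrite (rsum_ext _ _ (fun j => e j ^ 2 + (-1) * (delta z j * e j ^ 2)))
            by (intros; ring).
          rewrite rsum_plus, rsum_scal, rsum_delta, he, e1 by assumption. ring. }
        assert (g : e i ^ 2 - delta z i * e i ^ 2 <= 0).
        { rewrite <- h. apply (rsum_ge_term n i (fun j => e j ^ 2 - delta z j * e j ^ 2));
            [|assumption].
          intros j _. unfold delta. destruct (Nat.eqb z j); nra. }
        rewrite delta_off in g by lia. nra.
  (* The reflection is I - (2 / |w|^2) w w^T with w = e - e_z. As |w|^2 = 2 (1 - e z), its
     coefficient is [c]. *)
  - set (c := / (1 - e z)).
    assert (hc : c * (1 - e z) = 1) by (unfold c; field; lra).
    set (w := fun i => e i - delta z i).
    assert (hw : rsum n (fun i => w i * w i) = 2 * (1 - e z)).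
    { unfold w.
      rewrite (rsum_ext _ _ (fun i => e i ^ 2 + delta z i * (delta z i - 2 * e i)))
        by (intros; ring).
      rewrite rsum_plus, he, rsum_delta, delta_diag by assumption. ring. }
    exists (fun i j => delta i j - c * w i * w j). split.
    + intros i j hi hj.
      rewrite (rsum_ext _ _ (fun l => delta i l * (delta j l - c * w j * w l)
         + ((- c * w i) * (delta j l * w l) + (c * c * w i * w j) * (w l * w l))))
        by (intros; ring).
      rewrite rsum_plus, rsum_plus, !rsum_scal, !rsum_delta, hw by assumption.
      rewrite (delta_sym j i). change (if Nat.eqb i j then 1 else 0) with (delta i j).
      transitivity (delta i j + 2 * c * w i * w j * (c * (1 - e z) - 1)); [ring|].
      rewrite hc. ring.
    + intros i hi. unfold w. rewrite delta_diag, (delta_sym i z).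
      transitivity (delta z i + (c * (1 - e z)) * (e i - delta z i)); [ring|].
      rewrite hc. ring.
Qed.

Lemma eigen_decomp_rank1 (n : nat) (a b : R) (x : nat -> R) :
  (1 <= n)%nat -> exists Q,
  eigen_decomp n (fun i j => a * delta i j + b * x i * x j) Q
    (axial n a (a + b * norm2 n x)).
Proof.
  intros hn.
  assert (exists Q, orthogonal n Q /\ forall i j, (i < n)%nat -> (j < n)%nat ->
    x i * x j = norm2 n x * (Q i (n - 1)%nat * Q j (n - 1)%nat)) as (Q & oQ & hQ).
  (* For x = 0 there is no direction to normalise, and both sides vanish whatever [Q] is. *)
  { destruct (Req_dec (norm2 n x) 0) as [h0|hne].
    - exists delta. split.
      + intros i j hi hj. rewrite rsum_delta by assumption. apply delta_sym.
      + intros i j hi hj.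
        assert (x i ^ 2 <= 0).
        { rewrite <- h0. apply (rsum_ge_term n i (fun i => x i ^ 2)); [|assumption].
          intros; nra. }
        assert (x i = 0) by nra. rewrite h0, H0. ring.
    - assert (hpos : 0 < norm2 n x).
      { assert (0 <= norm2 n x) by (apply rsum_nonneg; intros; nra). lra. }
      set (r := sqrt (norm2 n x)).
      assert (hr : r * r = norm2 n x) by (apply sqrt_sqrt; lra).
      assert (r <> 0) by (intros e; rewrite e in hr; lra).
      destruct (orthogonal_last_column n (fun i => x i / r) hn) as (Q & oQ & hQ).
      { rewrite (rsum_ext _ _ (fun i => / (r * r) * x i ^ 2))
          by (intros; field; assumption).
        rewrite rsum_scal. fold (norm2 n x). rewrite hr. field. assumption. }
      exists Q. split; [assumption|]. intros i j hi hj.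
      rewrite !hQ, <- hr by assumption. field. assumption. }
  exists Q. split; [assumption|]. intros i j hi hj. unfold axial.
  rewrite (rsum_ext _ _ (fun l => a * (Q i l * Q j l)
     + (b * norm2 n x) * (delta (n - 1) l * (Q i l * Q j l)))) by (intros; ring).
  rewrite rsum_plus, !rsum_scal, rsum_delta by lia.
  rewrite (oQ i j hi hj), Rmult_assoc, hQ by assumption.
  unfold delta. ring.
Qed.

(** * Elementary symmetric polynomials of a rank-one perturbation *)

Lemma C_n_0 (n : nat) : C n 0 = 1.
Proof. unfold C. rewrite Nat.sub_0_r. simpl. field. apply INR_fact_neq_0. Qed.

Lemma C_n_n (n : nat) : C n n = 1.
Proof. unfold C. rewrite Nat.sub_diag. simpl. field. apply INR_fact_neq_0. Qed.

Lemma C_pos (n k : nat) : 0 < C n k.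
Proof.
  unfold C. apply Rdiv_lt_0_compat; [|apply Rmult_lt_0_compat];
    apply INR_fact_lt_0.
Qed.

Lemma C_absorb (n k : nat) :
  (k <= n)%nat -> INR (S k) * C (S n) (S k) = INR (S n) * C n k.
Proof.
  intros hk. unfold C. replace (S n - S k)%nat with (n - k)%nat by lia.
  rewrite !fact_simpl, !mult_INR. field.
  repeat split; try apply INR_fact_neq_0. apply not_0_INR. lia.
Qed.

Lemma esym_ext (l l' : nat -> R) (m k : nat) :
  (forall i, (i < m)%nat -> l i = l' i) -> esym l m k = esym l' m k.
Proof.
  revert k. induction m as [|m IH]; intros k E; simpl; [reflexivity|].
  destruct k; [reflexivity|].
  rewrite !IH by (intros; apply E; lia). now rewrite E by lia.
Qed.

Lemma esym_gt (l : nat -> R) (m k : nat) : (m < k)%nat -> esym l m k = 0.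
Proof.
  revert k. induction m as [|m IH]; intros [|k] h; simpl; try lia; [reflexivity|].
  rewrite !IH by lia. ring.
Qed.

Lemma esym_const (a : R) (m k : nat) :
  (k <= m)%nat -> esym (fun _ => a) m k = C m k * a ^ k.
Proof.
  revert k. induction m as [|m IH]; intros [|k] h.
  - simpl. rewrite C_n_0. ring.
  - lia.
  - simpl. rewrite C_n_0. ring.
  - cbn [esym]. rewrite (IH k) by lia.
    destruct (Nat.eq_dec k m) as [->|ne].
    + rewrite esym_gt, !C_n_n by lia. simpl. ring.
    + rewrite (IH (S k)), <- (pascal m k) by lia. simpl. ring.
Qed.

(** Splitting off the last eigenvalue gives C(n,k+1) a^(k+1) + p C(n,k) a^k. Pascal's rule and
    absorption then factor out C(n+1,k+1) a^k, leaving a weighted mean of a and p, the form in which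
    the equation becomes a divergence. *)
Lemma esym_axial (n k : nat) (a p : R) :
  (k < n)%nat ->
  esym (axial (S n) a p) (S n) (S k) =
  C (S n) (S k) * a ^ k * (a + INR (S k) / INR (S n) * (p - a)).
Proof.
  intros hk. cbn [esym].
  rewrite !(esym_ext (axial (S n) a p) (fun _ => a)).
  2, 3: intros i hi; unfold axial; rewrite delta_off by lia; ring.
  rewrite !esym_const by lia. unfold axial.
  replace (S n - 1)%nat with n by lia. rewrite delta_diag.
  assert (E : C n k = INR (S k) / INR (S n) * C (S n) (S k)).
  { assert (INR (S n) <> 0) by (apply not_0_INR; lia).
    apply (Rmult_eq_reg_l (INR (S n))); [|assumption].
    rewrite <- C_absorb by lia. field. assumption. }
  assert (P := pascal n k hk).
  transitivity (C n (S k) * a * a ^ k + (a + (p - a)) * (C n k * a ^ k)).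
  { simpl. ring. }
  replace (C n (S k)) with (C (S n) (S k) - C n k) by lra.
  rewrite E. ring.
Qed.

Lemma Sk_rank1 (n k : nat) (a b : R) (x : nat -> R) (H : nat -> nat -> R) :
  (1 <= k < n)%nat ->
  (forall i j, (i < n)%nat -> (j < n)%nat -> H i j = a * delta i j + b * x i * x j) ->
  Sk n k H = C n k * a ^ (k - 1) * (a + INR k / INR n * (b * norm2 n x)).
Proof.
  intros hk hH.
  destruct (eigen_decomp_rank1 n a b x ltac:(lia)) as (Q & oQ & dec).
  rewrite (Sk_eigen_decomp n k H Q (axial n a (a + b * norm2 n x))).
  - destruct n as [|n]; [lia|]. destruct k as [|k]; [lia|].
    rewrite esym_axial by lia. replace (S k - 1)%nat with k by lia.
    f_equal. f_equal. f_equal. ring.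
  - split; [assumption|]. intros i j hi hj. rewrite hH by assumption. now apply dec.
Qed.

(** * Counting the positive roots d *)

Lemma incr_of_derive_pos (f df : R -> R) (a b : R) :
  a < b ->
  (forall x, a <= x <= b -> is_derive f x (df x)) ->
  (forall x, a < x < b -> 0 < df x) -> f a < f b.
Proof.
  intros hab hd hpos.
  destruct (MVT_cor2 f df a b hab) as (c & hc & hcab).
  - intros c hc. apply is_derive_Reals, hd, hc.
  - specialize (hpos c hcab). nra.
Qed.

Definition profile_log (k d : R) : R := k * ln d - (k + 1) * ln (d + 1).

Lemma is_derive_profile_log (k d : R) :
  0 < d -> is_derive (profile_log k) d ((k - d) / (d * (d + 1))).
Proof.
  intros hd. unfold profile_log. auto_derive; [lra|]. field. lra.
Qed.

Lemma profile_log_incr (k a b : R) :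
  0 < a < b -> b <= k -> profile_log k a < profile_log k b.
Proof.
  intros hab hk.
  apply (incr_of_derive_pos _ (fun d => (k - d) / (d * (d + 1)))); [lra| |].
  - intros x hx. apply is_derive_profile_log. lra.
  - intros x hx. apply Rdiv_lt_0_compat; nra.
Qed.

Lemma profile_log_decr (k a b : R) :
  0 < k <= a -> a < b -> profile_log k b < profile_log k a.
Proof.
  intros hk hab. apply Ropp_lt_cancel.
  apply (incr_of_derive_pos (fun d => - profile_log k d)
    (fun d => - ((k - d) / (d * (d + 1))))); [lra| |].
  - intros x hx. apply (is_derive_opp (profile_log k)), is_derive_profile_log. lra.
  - intros x hx. replace (- ((k - x) / (x * (x + 1)))) with ((x - k) / (x * (x + 1)))
      by (field; nra).
    apply Rdiv_lt_0_compat; nra.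
Qed.

Section Roots.
Variables (k : nat) (K : R).
Hypothesis (hk : (1 <= k)%nat) (hK : 0 < K).

Lemma root_iff_log (lam d : R) : 0 < lam -> 0 < d ->
  lam * (d + 1) ^ (k + 1) - K * d ^ k = 0 <->
  profile_log (INR k) d = ln lam - ln K.
Proof.
  intros hl hd. unfold profile_log.
  assert (h1 : 0 < (d + 1) ^ (k + 1)) by (apply pow_lt; lra).
  assert (h2 : 0 < d ^ k) by (apply pow_lt; lra).
  assert (e1 : ln (lam * (d + 1) ^ (k + 1)) = ln lam + (INR k + 1) * ln (d + 1)).
  { rewrite ln_mult, ln_pow, plus_INR by lra. reflexivity. }
  assert (e2 : ln (K * d ^ k) = ln K + INR k * ln d).
  { rewrite ln_mult, ln_pow by lra. reflexivity. }
  split; intros h.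
  - replace (lam * (d + 1) ^ (k + 1)) with (K * d ^ k) in e1 by lra. lra.
  - assert (lam * (d + 1) ^ (k + 1) = K * d ^ k); [|lra].
    apply ln_inv; [nra|nra|]. lra.
Qed.

Let kpos : 0 < INR k.
Proof. apply lt_0_INR. lia. Qed.

(** The coefficient is the maximum over d > 0 of K d^k / (d+1)^(k+1). It is reached at d = k, and
    strict monotonicity on either side excludes any other point. *)
Lemma root_peak (d : R) : 0 < d ->
  K * INR k ^ k / (INR k + 1) ^ (k + 1) * (d + 1) ^ (k + 1) - K * d ^ k = 0 ->
  d = INR k.
Proof.
  intros hd h.
  set (mu := K * INR k ^ k / (INR k + 1) ^ (k + 1)) in *.
  assert (hp : 0 < (INR k + 1) ^ (k + 1)) by (apply pow_lt; lra).
  assert (hp' : 0 < INR k ^ k) by (apply pow_lt; lra).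
  assert (hmu : 0 < mu) by (apply Rdiv_lt_0_compat; nra).
  apply root_iff_log in h; [|assumption..].
  assert (h' : mu * (INR k + 1) ^ (k + 1) - K * INR k ^ k = 0)
    by (unfold mu; field; lra).
  apply root_iff_log in h'; [|assumption..].
  destruct (Rtotal_order d (INR k)) as [lt|[eq|gt]]; [|exact eq|].
  - assert (g := profile_log_incr (INR k) d (INR k) ltac:(lra) ltac:(lra)). lra.
  - assert (g := profile_log_decr (INR k) (INR k) d ltac:(lra) ltac:(lra)). lra.
Qed.

(** Existence comes from the signs of G at 0, k and a large b, which are positive, negative,
    positive. Uniqueness on each side of k comes from [profile_log], since G itself need not be
    monotone there. *)
Lemma two_roots (lam : R) :
  0 < lam < K * INR k ^ k / (INR k + 1) ^ (k + 1) ->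
  exists dm dp, 0 < dm < dp /\
    lam * (dm + 1) ^ (k + 1) - K * dm ^ k = 0 /\
    lam * (dp + 1) ^ (k + 1) - K * dp ^ k = 0 /\
    forall d, 0 < d -> lam * (d + 1) ^ (k + 1) - K * d ^ k = 0 -> d = dm \/ d = dp.
Proof.
  intros [hl hlmu].
  set (G := fun d => lam * (d + 1) ^ (k + 1) - K * d ^ k).
  assert (cG : continuity G) by (unfold G; reg).
  assert (hp : 0 < (INR k + 1) ^ (k + 1)) by (apply pow_lt; lra).
  assert (G0 : 0 < G 0).
  { unfold G. rewrite Rplus_0_l, pow1, pow_i by lia. lra. }
  assert (Gk : G (INR k) < 0).
  { unfold G. apply (Rmult_lt_compat_r _ _ _ hp) in hlmu.
    unfold Rdiv in hlmu. rewrite Rmult_assoc, Rinv_l in hlmu by lra. lra. }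
  (* Chosen so that lam (b+1) > K, hence lam (b+1)^(k+1) > K (b+1)^k >= K b^k. *)
  set (b := INR k + K / lam).
  assert (hKl : 0 < K / lam) by (apply Rdiv_lt_0_compat; lra).
  assert (Gb : 0 < G b).
  { unfold G. assert (hb : 0 < b ^ k) by (apply pow_lt; unfold b; lra).
    assert (b ^ k <= (b + 1) ^ k) by (apply pow_incr; unfold b; lra).
    replace (k + 1)%nat with (S k) by lia. cbn [pow].
    assert (e : lam * b = lam * INR k + K) by (unfold b; field; lra).
    assert (lam * (b + 1) > K) by nra. nra. }
  destruct (IVT (fun d => - G d) 0 (INR k)) as (dm & hdm & Gdm).
  { apply continuity_opp, cG. } { exact kpos. } { lra. } { lra. }
  destruct (IVT G (INR k) b) as (dp & hdp & Gdp).
  { exact cG. } { unfold b; lra. } { lra. } { lra. }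
  assert (dm <> 0) by (intros ->; lra).
  assert (dm <> INR k) by (intros ->; lra).
  assert (dp <> INR k) by (intros ->; lra).
  exists dm, dp. repeat split; [lra|lra|unfold G in Gdm; lra|exact Gdp|].
  intros d hd h.
  apply root_iff_log in h; [|assumption..].
  assert (Gdm' : lam * (dm + 1) ^ (k + 1) - K * dm ^ k = 0) by (unfold G in Gdm; lra).
  apply root_iff_log in Gdm'; [|lra..].
  assert (Gdp' : lam * (dp + 1) ^ (k + 1) - K * dp ^ k = 0) by exact Gdp.
  apply root_iff_log in Gdp'; [|lra..].
  destruct (Rle_or_lt d (INR k)) as [le|gt].
  - left. destruct (Rtotal_order d dm) as [lt|[eq|gt]]; [|exact eq|].
    + assert (g := profile_log_incr (INR k) d dm ltac:(lra) ltac:(lra)). lra.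
    + assert (g := profile_log_incr (INR k) dm d ltac:(lra) ltac:(lra)). lra.
  - right. destruct (Rtotal_order d dp) as [lt|[eq|gt']]; [|exact eq|].
    + assert (g := profile_log_decr (INR k) d dp ltac:(lra) ltac:(lra)). lra.
    + assert (g := profile_log_decr (INR k) dp d ltac:(lra) ltac:(lra)). lra.
Qed.
End Roots.

(** * Continuity relative to a subset of R^n *)

Definition near_within (n : nat) (S : pt -> Prop) (x : pt) (P : pt -> Prop) : Prop :=
  exists delta, delta > 0 /\ forall y, S y -> dist2 n y x < delta ^ 2 -> P y.

Lemma near_within_filter (n : nat) (S : pt -> Prop) (x : pt) : Filter (near_within n S x).
Proof.
  constructor.
  - exists 1. split; [lra|auto].
  - intros P Q (d & hd & hP) (e & he & hQ).
    exists (Rmin d e). split; [now apply Rmin_Rgt_r|].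
    intros y Sy hy.
    assert (0 < Rmin d e) by now apply Rmin_Rgt_r.
    assert (hm1 := Rmin_l d e). assert (hm2 := Rmin_r d e).
    split; [apply hP|apply hQ]; try assumption; nra.
  - intros P Q hPQ (d & hd & hP). exists d. split; [assumption|].
    intros y Sy hy. apply hPQ, hP; assumption.
Qed.

(** Restated as a limit along a filter, [cont_within] inherits the rules for sums, products and
    composition. *)
Lemma cont_within_filterlim (n : nat) (S : pt -> Prop) (f : pt -> R) (x : pt) :
  cont_within n S f x <-> filterlim f (near_within n S x) (locally (f x)).
Proof.
  split.
  - intros hc P [eps hP]. destruct (hc eps (cond_pos eps)) as (d & hd & h).
    exists d. split; [assumption|]. intros y Sy hy. apply hP, h; assumption.
  - intros hf eps heps.
    apply (hf (fun z => Rabs (z - f x) < eps)).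
    exists (mkposreal eps heps). intros z hz. exact hz.
Qed.

Lemma cont_within_const (n : nat) (S : pt -> Prop) (c : R) (x : pt) :
  cont_within n S (fun _ => c) x.
Proof.
  intros eps heps. exists 1. split; [lra|]. intros. now rewrite Rminus_diag, Rabs_R0.
Qed.

Lemma cont_within_plus (n : nat) (S : pt -> Prop) (f g : pt -> R) (x : pt) :
  cont_within n S f x -> cont_within n S g x -> cont_within n S (fun y => f y + g y) x.
Proof.
  rewrite !cont_within_filterlim. intros hf hg.
  assert (F := near_within_filter n S x).
  exact (filterlim_comp_2 _ _ _ hf hg (filterlim_plus (f x) (g x))).
Qed.

Lemma cont_within_mult (n : nat) (S : pt -> Prop) (f g : pt -> R) (x : pt) :
  cont_within n S f x -> cont_within n S g x -> cont_within n S (fun y => f y * g y) x.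
Proof.
  rewrite !cont_within_filterlim. intros hf hg.
  assert (F := near_within_filter n S x).
  exact (filterlim_comp_2 _ _ _ hf hg (filterlim_mult (f x) (g x))).
Qed.

Lemma cont_within_comp (n : nat) (S : pt -> Prop) (g : R -> R) (f : pt -> R) (x : pt) :
  cont_within n S f x -> continuous g (f x) -> cont_within n S (fun y => g (f y)) x.
Proof.
  rewrite !cont_within_filterlim. intros hf hg.
  exact (filterlim_comp _ _ _ _ _ _ _ _ hf hg).
Qed.

Lemma cont_within_coord (n i : nat) (S : pt -> Prop) (x : pt) :
  (i < n)%nat -> cont_within n S (fun y => y i) x.
Proof.
  intros hi eps heps. exists eps. split; [assumption|]. intros y Sy hy.
  assert ((y i - x i) ^ 2 <= dist2 n y x).
  { apply (rsum_ge_term n i (fun i => (y i - x i) ^ 2)); [|assumption]. intros; apply pow2_ge_0. }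
  apply Rabs_def1; nra.
Qed.

Lemma cont_within_rsum (n m : nat) (S : pt -> Prop) (f : nat -> pt -> R) (x : pt) :
  (forall i, (i < m)%nat -> cont_within n S (f i) x) ->
  cont_within n S (fun y => rsum m (fun i => f i y)) x.
Proof.
  induction m as [|m IH]; intros h; simpl.
  - apply cont_within_const.
  - apply (cont_within_plus n S (fun y => rsum m (fun i => f i y)) (f m)).
    + apply IH. intros; apply h; lia.
    + apply h; lia.
Qed.

Lemma cont_within_norm2 (n : nat) (S : pt -> Prop) (x : pt) :
  cont_within n S (norm2 n) x.
Proof.
  apply (cont_within_rsum n n S (fun i y => y i ^ 2)). intros i hi.
  apply (cont_within_comp n S (fun t => t ^ 2) (fun y => y i)).
  - now apply cont_within_coord.
  - apply continuity_pt_filterlim. reg.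
Qed.

(** * Differentiation along coordinate directions *)

Lemma norm2_nonneg (n : nat) (x : pt) : 0 <= norm2 n x.
Proof. apply rsum_nonneg. intros; nra. Qed.

Lemma shift_delta (i j : nat) (t : R) (x : pt) : shift i t x j = x j + t * delta i j.
Proof.
  unfold shift, delta. rewrite Nat.eqb_sym. destruct (Nat.eqb i j); ring.
Qed.

Lemma norm2_shift (n i : nat) (t : R) (x : pt) :
  (i < n)%nat -> norm2 n (shift i t x) = norm2 n x + (2 * x i * t + t ^ 2).
Proof.
  intros hi. unfold norm2.
  rewrite (rsum_ext _ _ (fun j => x j ^ 2 + delta i j * (2 * x j * t + t ^ 2 * delta i j))).
  - rewrite rsum_plus, rsum_delta, delta_diag by assumption. ring.
  - intros j _. rewrite shift_delta. ring.
Qed.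

Lemma in_Rn_shift (n i : nat) (t : R) (x : pt) :
  (i < n)%nat -> in_Rn n x -> in_Rn n (shift i t x).
Proof.
  intros hi hx j hj. rewrite shift_delta, hx, delta_off by lia. ring.
Qed.

Lemma Rpower_minus_1 (a e : R) : 0 < a -> Rpower a (e - 1) = Rpower a e / a.
Proof.
  intros ha. unfold Rminus. rewrite Rpower_plus, Rpower_Ropp, Rpower_1 by assumption.
  reflexivity.
Qed.

(** With s = |x|^2 and a = x_i, the inner expression is the squared norm of x shifted by t in
    direction i, as in [norm2_shift]. *)
Lemma is_derive_Rpower_affine (d s a e : R) : 0 < 1 + d * s ->
  is_derive (fun t => Rpower (1 + d * (s + (2 * a * t + t ^ 2))) e) 0
    (e * (2 * d * a) * Rpower (1 + d * s) (e - 1)).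
Proof.
  intros h. unfold Rpower at 1.
  auto_derive.
  - replace (s + _) with s by ring. repeat split; trivial.
  - replace (s + _) with s by ring.
    rewrite Rpower_minus_1 by assumption. unfold Rpower. field. lra.
Qed.

Lemma continuous_Rpower_affine (d s e : R) : 0 < 1 + d * s ->
  continuous (fun s => Rpower (1 + d * s) e) s.
Proof.
  intros h. apply (@ex_derive_continuous R_AbsRing R_NormedModule).
  unfold Rpower. auto_derive. exact h.
Qed.

(** * The bubbles solve the problem *)

Definition bexp (n k : nat) : R := (INR n - 2 * INR k) / (2 * INR k).

(** The candidate with [lam] eliminated by the root equation. The zero boundary value is visible,
    and [ustar] is convertible to the case d = k. *)
Definition bubble (n k : nat) (d : R) (x : pt) : R :=
  1 - Rpower ((1 + d) / (1 + d * norm2 n x)) (bexp n k).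

Section Candidate.
Variables (n k : nat) (d : R).
Hypothesis (hk : (1 <= k)%nat) (hn : (2 * k < n)%nat) (hd : 0 < d).

Notation m := (bexp n k).
Notation den x := (1 + d * norm2 n x).

Lemma INR_bounds : 1 <= INR k /\ 2 * INR k < INR n.
Proof.
  split; [apply (le_INR 1), hk|].
  apply lt_INR in hn. rewrite mult_INR in hn. exact hn.
Qed.

Lemma bexp_pos : 0 < m.
Proof. destruct INR_bounds. apply Rdiv_lt_0_compat; lra. Qed.

Lemma den_pos (x : pt) : 1 <= den x.
Proof. assert (h := norm2_nonneg n x). nra. Qed.

Lemma bubble_eq (x : pt) :
  bubble n k d x = 1 - Rpower (1 + d) m * Rpower (den x) (- m).
Proof.
  unfold bubble. assert (h := den_pos x). f_equal.
  unfold Rdiv. rewrite <- Rpower_mult_distr; [|lra|apply Rinv_0_lt_compat; lra].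
  f_equal. unfold Rpower. rewrite ln_Rinv by lra. f_equal. ring.
Qed.

(** The gradient of the bubble is [grad_coef] times x; differentiating once more gives the Hessian
    [grad_coef] I + [hess_coef] x x^T. *)
Definition grad_coef (x : pt) : R :=
  2 * m * d * Rpower (1 + d) m * Rpower (den x) (- m - 1).
Definition hess_coef (x : pt) : R :=
  - (4 * m * (m + 1) * d ^ 2 * Rpower (1 + d) m) * Rpower (den x) (- m - 1 - 1).

Lemma bubble_partial (x : pt) (i : nat) : (i < n)%nat ->
  has_partial (bubble n k d) i x (grad_coef x * x i).
Proof.
  intros hi. apply is_derive_Reals.
  apply (is_derive_ext (fun t => 1 - Rpower (1 + d) m *
    Rpower (1 + d * (norm2 n x + (2 * x i * t + t ^ 2))) (- m))).
  { intros t. rewrite bubble_eq, norm2_shift by assumption. reflexivity. }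
  assert (h := den_pos x).
  assert (D := is_derive_Rpower_affine d (norm2 n x) (x i) (- m) ltac:(lra)).
  set (F := fun t => Rpower (1 + d * (norm2 n x + (2 * x i * t + t ^ 2))) (- m)).
  change (is_derive F 0 (- m * (2 * d * x i) * Rpower (den x) (- m - 1))) in D.
  change (is_derive (fun t => 1 - Rpower (1 + d) m * F t) 0 (grad_coef x * x i)).
  clearbody F. auto_derive.
  - eexists; exact D.
  - rewrite (is_derive_unique (fun t : R => F t) _ _ D).
    unfold grad_coef. ring.
Qed.

Lemma bubble_partial2 (x : pt) (i j : nat) : (i < n)%nat -> (j < n)%nat ->
  has_partial (fun y => grad_coef y * y i) j x
    (grad_coef x * delta i j + hess_coef x * x i * x j).
Proof.
  intros hi hj. apply is_derive_Reals.
  apply (is_derive_ext (fun t => (2 * m * d * Rpower (1 + d) m) *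
    Rpower (1 + d * (norm2 n x + (2 * x j * t + t ^ 2))) (- m - 1) *
    (x i + t * delta j i))).
  { intros t. unfold grad_coef. rewrite norm2_shift, shift_delta by assumption.
    reflexivity. }
  assert (h := den_pos x).
  assert (D := is_derive_Rpower_affine d (norm2 n x) (x j) (- m - 1) ltac:(lra)).
  set (F := fun t => Rpower (1 + d * (norm2 n x + (2 * x j * t + t ^ 2))) (- m - 1)).
  change (is_derive F 0 ((- m - 1) * (2 * d * x j) * Rpower (den x) (- m - 1 - 1))) in D.
  change (is_derive (fun t => (2 * m * d * Rpower (1 + d) m) * F t * (x i + t * delta j i)) 0
    (grad_coef x * delta i j + hess_coef x * x i * x j)).
  assert (F0 : F 0 = Rpower (den x) (- m - 1)) by (unfold F; do 2 f_equal; ring).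
  clearbody F. auto_derive.
  - eexists; exact D.
  - rewrite (is_derive_unique (fun t : R => F t) _ _ D), F0.
    unfold grad_coef, hess_coef. rewrite (delta_sym j i). ring.
Qed.

Lemma cont_within_Rpower_den (S : pt -> Prop) (e : R) (x : pt) :
  cont_within n S (fun y => Rpower (den y) e) x.
Proof.
  apply (cont_within_comp n S (fun s => Rpower (1 + d * s) e) (norm2 n)).
  - apply cont_within_norm2.
  - apply continuous_Rpower_affine. assert (h := den_pos x). lra.
Qed.

Lemma cont_within_ext (S : pt -> Prop) (f g : pt -> R) (x : pt) :
  (forall y, f y = g y) -> cont_within n S f x -> cont_within n S g x.
Proof.
  intros E h eps heps. destruct (h eps heps) as (e & he & H).
  exists e. split; [assumption|]. intros y. rewrite <- !E. apply H.
Qed.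

Lemma cont_within_bubble (S : pt -> Prop) (x : pt) : cont_within n S (bubble n k d) x.
Proof.
  apply (cont_within_ext S (fun y => 1 + - Rpower (1 + d) m * Rpower (den y) (- m))).
  { intros y. rewrite bubble_eq. ring. }
  apply cont_within_plus; [apply cont_within_const|].
  apply cont_within_mult; [apply cont_within_const|apply cont_within_Rpower_den].
Qed.

Lemma bubble_C2 : is_C2_on_ball n (bubble n k d)
  (fun i x => grad_coef x * x i)
  (fun i j x => grad_coef x * delta i j + hess_coef x * x i * x j).
Proof.
  assert (cg : forall x, cont_within n (in_Rn n) grad_coef x).
  { intros x. apply cont_within_mult; [apply cont_within_const|].
    apply cont_within_Rpower_den. }
  assert (ch : forall x, cont_within n (in_Rn n) hess_coef x).
  { intros x. apply cont_within_mult; [apply cont_within_const|].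
    apply cont_within_Rpower_den. }
  intros x hx. split; [apply cont_within_bubble|].
  intros i hi. split; [now apply bubble_partial|]. split.
  { apply cont_within_mult; [apply cg|now apply cont_within_coord]. }
  intros j hj. split; [now apply bubble_partial2|].
  apply (cont_within_plus n _ (fun x => grad_coef x * delta i j)
    (fun x => hess_coef x * x i * x j)).
  - apply cont_within_mult; [apply cg|apply cont_within_const].
  - apply (cont_within_mult n _ (fun x => hess_coef x * x i) (fun x => x j));
      [|now apply cont_within_coord].
    apply cont_within_mult; [apply ch|now apply cont_within_coord].
Qed.

(** Since 2 (m+1) = n / k, [hess_coef] equals -(n/k) (d/den) [grad_coef], and the weight i/n of
    [Sk_rank1] turns into i/k. The last factor is therefore 1/den at i = k and nonnegative for every
    i <= k. *)
Lemma Sk_bubble (i : nat) (x : pt) : (1 <= i <= k)%nat ->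
  Sk n i (fun a b => grad_coef x * delta a b + hess_coef x * x a * x b) =
  C n i * grad_coef x ^ i * (1 - INR i / INR k * (d * norm2 n x / den x)).
Proof.
  intros hi. destruct INR_bounds. assert (h := den_pos x).
  rewrite (Sk_rank1 n i (grad_coef x) (hess_coef x) x) by (intros; lia || reflexivity).
  assert (E : hess_coef x = - (INR n / INR k) * d / den x * grad_coef x).
  { unfold hess_coef, grad_coef. rewrite (Rpower_minus_1 (den x) (- m - 1)) by lra.
    unfold bexp. field. lra. }
  rewrite E. destruct i as [|i]; [lia|]. replace (S i - 1)%nat with i by lia.
  cbn [pow]. field. lra.
Qed.

Lemma grad_coef_pos (x : pt) : 0 < grad_coef x.
Proof.
  unfold grad_coef. assert (h := bexp_pos).
  repeat first [assumption | lra | apply exp_pos | apply Rmult_lt_0_compat].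
Qed.

Lemma Sk_bubble_nonneg (i : nat) (x : pt) : (1 <= i <= k)%nat ->
  Sk n i (fun a b => grad_coef x * delta a b + hess_coef x * x a * x b) >= 0.
Proof.
  intros hi. rewrite Sk_bubble by assumption. destruct INR_bounds.
  assert (hs := norm2_nonneg n x).
  assert (h := den_pos x). apply Rle_ge.
  assert (a1 := C_pos n i). assert (a2 := pow_lt _ i (grad_coef_pos x)).
  apply Rmult_le_pos; [nra|].
  assert (INR i <= INR k) by (apply le_INR; lia).
  assert (0 <= INR i) by apply pos_INR.
  assert (INR i / INR k <= 1) by (apply Rle_div_l; lra).
  assert (0 <= INR i / INR k) by (apply Rle_mult_inv_pos; lra).
  assert (d * norm2 n x / den x <= 1) by (apply Rle_div_l; lra).
  assert (0 <= d * norm2 n x / den x) by (apply Rle_mult_inv_pos; nra).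
  nra.
Qed.

Lemma two_bexp : 2 * m = (INR n - 2 * INR k) / INR k.
Proof. destruct INR_bounds. unfold bexp. field. lra. Qed.

(** In logarithms, identities between real powers become linear in ln lam, ln d and ln (1+d), so
    that [field] can close them. *)
Lemma root_eq_log (lam : R) : 0 < lam -> root_eq n k lam d ->
  ln lam + (INR k + 1) * ln (1 + d) = ln (C n k) + INR k * ln (2 * m) + INR k * ln d.
Proof.
  intros hl hr. unfold root_eq in hr. rewrite <- two_bexp in hr.
  assert (hm := bexp_pos). assert (hC := C_pos n k).
  apply root_iff_log in hr; try assumption.
  2: { apply Rmult_lt_0_compat; [assumption|]. apply pow_lt. lra. }
  unfold profile_log in hr.
  rewrite ln_mult, ln_pow, (Rplus_comm d 1) in hr by (try apply pow_lt; lra).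
  lra.
Qed.

(** The powers of den agree because m q = n/2 + 1 = k (m+1) + 1, which is criticality. The remaining
    constants agree exactly by the root equation. *)
Lemma bubble_equation (lam : R) (x : pt) : 0 < lam -> root_eq n k lam d ->
  Sk n k (fun a b => grad_coef x * delta a b + hess_coef x * x a * x b) =
  lam * Rpower (1 - bubble n k d x) (qstar n k).
Proof.
  intros hl hr. apply root_eq_log in hr; [|assumption].
  destruct INR_bounds. assert (h := den_pos x). assert (hm := bexp_pos).
  rewrite Sk_bubble, bubble_eq by lia.
  replace (1 - INR k / INR k * (d * norm2 n x / den x)) with (/ den x) by (field; lra).
  replace (1 - (1 - Rpower (1 + d) m * Rpower (den x) (- m)))
    with (Rpower (1 + d) m * Rpower (den x) (- m)) by ring.
  assert (hC := C_pos n k). assert (hg := grad_coef_pos x).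
  assert (hg' := pow_lt _ k hg). assert (hi : 0 < / den x) by (apply Rinv_0_lt_compat; lra).
  assert (e1 : 0 < Rpower (1 + d) m) by apply exp_pos.
  assert (e2 : 0 < Rpower (den x) (- m)) by apply exp_pos.
  assert (e3 : 0 < Rpower (Rpower (1 + d) m * Rpower (den x) (- m)) (qstar n k))
    by apply exp_pos.
  apply ln_inv; [repeat first [assumption | apply Rmult_lt_0_compat]
    |apply Rmult_lt_0_compat; assumption|].
  rewrite !(ln_mult lam), !(ln_mult _ (/ den x)), ln_mult, ln_pow, ln_Rinv by nra.
  unfold grad_coef.
  replace (2 * m * d) with ((2 * m) * d) by ring.
  assert (e4 : 0 < Rpower (den x) (- m - 1)) by apply exp_pos.
  rewrite (ln_mult (2 * m * d * Rpower (1 + d) m)), (ln_mult (2 * m * d)),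
    (ln_mult (2 * m) d), !ln_Rpower, (ln_mult (Rpower (1 + d) m)), !ln_Rpower
    by (repeat first [assumption | lra | apply Rmult_lt_0_compat]).
  replace (ln lam) with (ln (C n k) + INR k * ln (2 * m) + INR k * ln d
    - (INR k + 1) * ln (1 + d)) by lra.
  generalize (ln (2 * m)). intros l2. unfold qstar, bexp. field. lra.
Qed.

Lemma bubble_sphere (x : pt) : norm2 n x = 1 -> bubble n k d x = 0.
Proof.
  intros h. unfold bubble. rewrite h, Rmult_1_r.
  unfold Rdiv, Rpower. rewrite Rinv_r, ln_1, Rmult_0_r, exp_0 by lra. ring.
Qed.

Lemma bubble_neg (x : pt) : norm2 n x < 1 -> bubble n k d x < 0.
Proof.
  intros h. unfold bubble. assert (h' := den_pos x).
  assert (1 < Rpower ((1 + d) / den x) m); [|lra].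
  rewrite <- (Rpower_O ((1 + d) / den x)) at 1.
  - apply Rpower_lt; [|apply bexp_pos]. apply Rlt_div_r; nra.
  - apply Rdiv_lt_0_compat; lra.
Qed.

Lemma bubble_solution (lam : R) : 0 < lam -> root_eq n k lam d ->
  is_solution n k lam (bubble n k d).
Proof.
  intros hl hr. do 2 eexists. split; [apply bubble_C2|]. split; [|split].
  - intros x _. apply cont_within_bubble.
  - intros x [_ hx]. split; [|split].
    + intros i hi. now apply Sk_bubble_nonneg.
    + now apply bubble_equation.
    + now apply bubble_neg.
  - intros x [_ hx]. now apply bubble_sphere.
Qed.

(** Raising lam (1+d)^(k+1) = C(n,k) (2 m d)^k to the power m/(k+1), which is [expo n k], identifies
    the two prefactors. *)
Lemma sol_from_bubble (lam : R) (x : pt) : 0 < lam -> root_eq n k lam d ->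
  sol_from n k lam d x = bubble n k d x.
Proof.
  intros hl hr. apply root_eq_log in hr; [|assumption].
  destruct INR_bounds. assert (h := den_pos x). assert (hm := bexp_pos).
  assert (hC := C_pos n k).
  rewrite bubble_eq. unfold sol_from, bliss.
  change ((INR n - 2 * INR k) / (2 * INR k)) with m.
  rewrite <- two_bexp, (Rpower_Ropp (den x)).
  assert (e0 : 0 < Rpower (C n k) (1 / INR k)) by apply exp_pos.
  assert (E : Rpower lam (- expo n k) *
     Rpower (d * Rpower (C n k) (1 / INR k) * (2 * m))
       ((INR n - 2 * INR k) / (2 * (INR k + 1))) = Rpower (1 + d) m).
  { unfold Rpower at 1 2 4. rewrite <- exp_plus. f_equal.
    rewrite (ln_mult (d * _)), (ln_mult d), ln_Rpower
      by (repeat first [assumption | lra | apply Rmult_lt_0_compat]).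
    replace (ln lam) with (ln (C n k) + INR k * ln (2 * m) + INR k * ln d
      - (INR k + 1) * ln (1 + d)) by lra.
    generalize (ln (2 * m)). intros l2. unfold expo, bexp. field. lra. }
  rewrite <- E. field. apply Rgt_not_eq, exp_pos.
Qed.

End Candidate.

(** * The radial ODE and its first integrals *)

Lemma mvt_open (f df : R -> R) (a b : R) : a < b ->
  (forall x, a < x < b -> is_derive f x (df x)) ->
  (forall x, a <= x <= b -> continuity_pt f x) ->
  exists c, a < c < b /\ f b - f a = df c * (b - a).
Proof.
  intros hab hd hc.
  pose (pr := fun c (hc : a < c < b) =>
    exist (fun l => derivable_pt_abs f c l) (df c) (proj1 (is_derive_Reals f c (df c)) (hd c hc))).
  destruct (MVT f id a b pr (fun c _ => derivable_pt_id c) hab hc) as (c & hcab & E).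
  { intros c _. apply derivable_continuous_pt, derivable_pt_id. }
  exists c. split; [assumption|].
  rewrite derive_pt_id in E. simpl in E. unfold id in E. lra.
Qed.

Lemma ex_derive_continuity_pt (f : R -> R) (x : R) : ex_derive f x -> continuity_pt f x.
Proof.
  intros h. apply continuity_pt_filterlim.
  exact (@ex_derive_continuous R_AbsRing R_NormedModule f x h).
Qed.

Section RadialODE.
Variables (n k : nat) (lam : R) (f p p1 : R -> R).
Hypothesis (hk : (1 <= k)%nat) (hn : (2 * k < n)%nat) (hlam : 0 < lam).
Hypothesis (df : forall r, -1 < r < 1 -> is_derive f r (p r)).
Hypothesis (dp : forall r, -1 < r < 1 -> is_derive p r (p1 r)).
Hypothesis (p0 : p 0 = 0).
Hypothesis (fneg : forall r, 0 <= r < 1 -> f r < 0).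
Hypothesis (eqk : forall r, 0 < r < 1 ->
  C n k * (p r / r) ^ (k - 1) * (p r / r + INR k / INR n * (p1 r - p r / r)) =
  lam * Rpower (1 - f r) (qstar n k)).
Hypothesis (eq1 : forall r, 0 < r < 1 -> 0 <= p r / r + 1 / INR n * (p1 r - p r / r)).
Hypothesis (f1 : forall eps, eps > 0 -> exists delta, delta > 0 /\
  forall r, 0 < r < 1 -> 1 - delta < r -> Rabs (f r) < eps).

Notation m := (bexp n k).
Notation q := (qstar n k).

Let Kk : 1 <= INR k := proj1 (INR_bounds n k hk hn).
Let Kn : 2 * INR k < INR n := proj2 (INR_bounds n k hk hn).
Let hm : 0 < m := bexp_pos n k hk hn.

Lemma Derive_profile (r : R) : -1 < r < 1 -> Derive (fun x : R => f x) r = p r.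
Proof. intros h. now apply is_derive_unique, df. Qed.

Lemma Derive_slope (r : R) : -1 < r < 1 -> Derive (fun x : R => p x) r = p1 r.
Proof. intros h. now apply is_derive_unique, dp. Qed.

Lemma ex_derive_profile (r : R) : -1 < r < 1 -> ex_derive (fun x : R => f x) r.
Proof. intros h. exists (p r). now apply df. Qed.

Lemma ex_derive_slope (r : R) : -1 < r < 1 -> ex_derive (fun x : R => p x) r.
Proof. intros h. exists (p1 r). now apply dp. Qed.

(** Writing both exponents as successors avoids truncated predecessors, and the formula remains
    valid at r = 0. *)
Lemma is_derive_flux (i j : nat) (r : R) : -1 < r < 1 ->
  is_derive (fun r => r ^ S i * p r ^ S j) r
    (r ^ i * p r ^ j * (INR (S j) * r * p1 r + INR (S i) * p r)).
Proof.
  intros hr. auto_derive.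
  - exists (p1 r). now apply dp.
  - rewrite Derive_slope by assumption.
    change (match j with 0%nat => 1 | S _ => INR j + 1 end) with (INR (S j)).
    change (match i with 0%nat => 1 | S _ => INR i + 1 end) with (INR (S i)).
    simpl pow. ring.
Qed.

(** S_1 is the Laplacian, and its sign says that r^(n-1) p is nondecreasing from its value 0 at the
    origin. *)
Lemma slope_nonneg (r : R) : 0 < r < 1 -> 0 <= p r.
Proof.
  intros hr. set (i := (n - 2)%nat).
  destruct (MVT_cor2 (fun r => r ^ S i * p r ^ 1)
    (fun r => r ^ i * p r ^ 0 * (INR 1 * r * p1 r + INR (S i) * p r)) 0 r) as (c & E & hc).
  { lra. }
  { intros c hc. apply is_derive_Reals, is_derive_flux. lra. }
  rewrite p0, !pow_1 in E.
  assert (h := eq1 c ltac:(lra)).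
  assert (hi : 0 < c ^ i) by (apply pow_lt; lra).
  assert (hr' : 0 < r ^ S i) by (apply pow_lt; lra).
  assert (E2 : INR 1 * c * p1 c + INR (S i) * p c =
     INR n * c * (p c / c + 1 / INR n * (p1 c - p c / c))).
  { replace (INR (S i)) with (INR n - 1).
    - simpl (INR 1). field. lra.
    - unfold i. replace (S (n - 2)) with (n - 1)%nat by lia.
      rewrite minus_INR by lia. reflexivity. }
  rewrite E2 in E.
  assert (g : 0 <= c ^ i * p c ^ 0 * (INR n * c *
    (p c / c + 1 / INR n * (p1 c - p c / c))) * (r - 0)).
  { simpl (p c ^ 0). repeat apply Rmult_le_pos; lra. }
  rewrite <- E in g. nra.
Qed.

Notation flux r := (r ^ (n - k) * p r ^ k).
Notation src r := (INR n / C n k * lam * (r ^ (n - 1) * Rpower (1 - f r) q)).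

Lemma flux_identity (r : R) : 0 < r < 1 ->
  r ^ (n - k - 1) * p r ^ (k - 1) * (INR k * r * p1 r + INR (n - k) * p r) = src r.
Proof.
  intros hr. assert (hC := C_pos n k).
  transitivity (INR n / C n k * r ^ (n - 1) * (lam * Rpower (1 - f r) q)); [|ring].
  rewrite <- eqk by assumption.
  rewrite minus_INR by lia.
  replace (n - 1)%nat with ((n - k - 1) + (k - 1) + 1)%nat by lia.
  rewrite !pow_add, pow_1.
  replace (p r ^ (k - 1)) with (r ^ (k - 1) * (p r / r) ^ (k - 1)).
  2: { rewrite <- Rpow_mult_distr. f_equal. field. lra. }
  field. lra.
Qed.

Lemma is_derive_flux_src (r : R) : 0 < r < 1 -> is_derive (fun r => flux r) r (src r).
Proof.
  intros hr. rewrite <- flux_identity by assumption.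
  assert (D := is_derive_flux (n - k - 1) (k - 1) r ltac:(lra)).
  replace (S (n - k - 1)) with (n - k)%nat in D by lia.
  replace (S (k - 1)) with k in D by lia.
  exact D.
Qed.

(** The flux has the positive derivative [src], so p cannot vanish; the sign is already known from
    [slope_nonneg]. *)
Lemma slope_pos (r : R) : 0 < r < 1 -> 0 < p r.
Proof.
  intros hr.
  (* The derivative equals [src] only for r > 0, while the flux is continuous up to r = 0 and
     vanishes there. *)
  destruct (mvt_open (fun r => flux r) (fun r => src r) 0 r) as (c & hc & E).
  { lra. }
  { intros x hx. apply is_derive_flux_src. lra. }
  { intros x hx.
    assert (D := is_derive_flux (n - k - 1) (k - 1) x ltac:(lra)).
    replace (S (n - k - 1)) with (n - k)%nat in D by lia.
    replace (S (k - 1)) with k in D by lia.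
    apply derivable_continuous_pt. eexists. apply is_derive_Reals, D. }
  rewrite (pow_i (n - k)) in E by lia.
  assert (hC := C_pos n k).
  assert (0 < src c * (r - 0)).
  { assert (0 < c ^ (n - 1)) by (apply pow_lt; lra).
    assert (0 < Rpower (1 - f c) q) by apply exp_pos.
    assert (0 < INR n / C n k) by (apply Rdiv_lt_0_compat; lra).
    repeat first [assumption | lra | apply Rmult_lt_0_compat]. }
  destruct (slope_nonneg r hr) as [h|h]; [exact h|].
  exfalso. rewrite <- h, (pow_i k) in E by lia. lra.
Qed.

(** This is (k+1)/k times the Noether invariant of the dilations v(r) -> s^a v(s r), a =
    (n-2k)/(k+1), which preserve the action of the radial equation exactly when q is critical. *)
Definition pohozaev (r : R) : R :=
  flux r * (r * p r - 2 * m * (1 - f r)) +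
  2 * m / C n k * lam * (r ^ n * Rpower (1 - f r) (q + 1)).

Lemma is_derive_pohozaev (r : R) : 0 < r < 1 -> is_derive pohozaev r 0.
Proof.
  intros hr. assert (hv := fneg r ltac:(lra)). assert (hC := C_pos n k).
  set (F := fun r => flux r).
  assert (DF : is_derive F r (src r)) by (apply is_derive_flux_src; assumption).
  assert (EF : F r = flux r) by reflexivity.
  change (is_derive (fun r => F r * (r * p r - 2 * m * (1 - f r)) +
    2 * m / C n k * lam * (r ^ n * exp ((q + 1) * ln (1 - f r)))) r 0).
  clearbody F.
  auto_derive.
  - assert (eF : ex_derive (fun x : R => F x) r) by (eexists; exact DF).
    assert (ef := ex_derive_profile r ltac:(lra)). assert (ep := ex_derive_slope r ltac:(lra)).
    repeat split; assumption || lra.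
  - rewrite Derive_slope, Derive_profile, (is_derive_unique (fun x : R => F x) _ _ DF), EF
      by lra.
    assert (I := flux_identity r hr).
    change (exp ((q + 1) * ln (1 + - f r))) with (Rpower (1 - f r) (q + 1)).
    rewrite Rpower_plus, Rpower_1 by lra.
    set (V := Rpower (1 - f r) q) in *.
    rewrite minus_INR in I by lia.
    replace (r ^ (n - k)) with (r * r ^ (n - k - 1))
      by (rewrite tech_pow_Rmult; f_equal; lia).
    replace (p r ^ k) with (p r * p r ^ (k - 1))
      by (rewrite tech_pow_Rmult; f_equal; lia).
    replace (r ^ n) with (r * r ^ (n - 1))
      by (rewrite tech_pow_Rmult; f_equal; lia).

    replace (Init.Nat.pred n) with (n - 1)%nat by lia.
    (* The derivative is r p / k times the residual of [flux_identity]. The source terms combine in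
       this way because 2 m (q+1) / n = (k+1) / k. *)
    transitivity (r * p r / INR k * (r ^ (n - k - 1) * p r ^ (k - 1) *
      (INR k * r * p1 r + (INR n - INR k) * p r) - INR n / C n k * lam * (r ^ (n - 1) * V))).
    + unfold qstar, bexp. field. repeat split; lra.
    + rewrite I. ring.
Qed.

Lemma pohozaev_zero (r : R) : 0 < r < 1 -> pohozaev r = 0.
Proof.
  intros hr.
  destruct (mvt_open pohozaev (fun _ => 0) 0 r) as (c & hc & E).
  { lra. }
  { intros x hx. apply is_derive_pohozaev. lra. }
  { intros x hx. assert (hv := fneg x ltac:(lra)).
    apply ex_derive_continuity_pt.
    assert (ef := ex_derive_profile x ltac:(lra)). assert (ep := ex_derive_slope x ltac:(lra)).
    unfold pohozaev, Rpower. auto_derive. repeat split; assumption || lra. }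
  assert (E0 : pohozaev 0 = 0).
  { unfold pohozaev. rewrite (pow_i (n - k)), (pow_i n) by lia. ring. }
  lra.
Qed.

Lemma slope_ode (r : R) : 0 < r < 1 ->
  (r * p1 r - p r) * (1 - f r) = - (1 + 1 / m) * r * p r ^ 2.
Proof.
  intros hr. assert (P := pohozaev_zero r hr). unfold pohozaev in P.
  assert (hv := fneg r ltac:(lra)). assert (hp := slope_pos r hr).
  assert (I := flux_identity r hr). assert (hC := C_pos n k).
  rewrite Rpower_plus, Rpower_1 in P by lra.
  set (V := Rpower (1 - f r) q) in *.
  rewrite minus_INR in I by lia.
  replace (r ^ (n - k)) with (r * r ^ (n - k - 1)) in P
    by (rewrite tech_pow_Rmult; f_equal; lia).
  replace (p r ^ k) with (p r * p r ^ (k - 1)) in P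
    by (rewrite tech_pow_Rmult; f_equal; lia).
  replace (r ^ n) with (r * r ^ (n - 1)) in P
    by (rewrite tech_pow_Rmult; f_equal; lia).
  assert (hX : 0 < r ^ (n - k - 1) * p r ^ (k - 1))
    by (apply Rmult_lt_0_compat; apply pow_lt; lra).
  set (X := r ^ (n - k - 1) * p r ^ (k - 1)) in *.
  (* [flux_identity] trades r^(n-1) V for an expression in p and p', and the positive factor X r
     comes out of every term. *)
  assert (Q : X * (r * (p r * (r * p r - 2 * m * (1 - f r)) +
     2 * m / INR n * (INR k * r * p1 r + (INR n - INR k) * p r) * (1 - f r))) = 0).
  { rewrite <- P. transitivity (X * r * (p r * (r * p r - 2 * m * (1 - f r))) +
      2 * m / INR n * r * (1 - f r) *
      (X * (INR k * r * p1 r + (INR n - INR k) * p r))); [field; lra|].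
    rewrite I. unfold X. field. lra. }
  apply Rmult_integral in Q. destruct Q as [Q|Q]; [lra|].
  apply Rmult_integral in Q. destruct Q as [Q|Q]; [lra|].
  assert (hmk : m * (2 * INR k) = INR n - 2 * INR k) by (unfold bexp; field; lra).
  (* This is the coefficient of (r p' - p) v once the terms in p v cancel; moreover n / (2 m k) = 1
     + 1/m. *)
  apply (Rmult_eq_reg_l (2 * m * INR k / INR n)).
  2: { apply Rgt_not_eq, Rdiv_lt_0_compat; [nra|lra]. }
  transitivity (- r * p r ^ 2).
  - transitivity (p r * (r * p r - 2 * m * (1 - f r)) +
     2 * m / INR n * (INR k * r * p1 r + (INR n - INR k) * p r) * (1 - f r)
     - r * p r ^ 2); [field; lra|]. rewrite Q. ring.
  - unfold bexp. field. lra.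
Qed.

(** This is m (v^(-1/m))' / r with v = 1 - f; its constancy integrates [slope_ode] once. *)
Definition slope_ratio (r : R) : R := p r / r * Rpower (1 - f r) (- (1 + 1 / m)).

Lemma is_derive_slope_ratio (r : R) : 0 < r < 1 -> is_derive slope_ratio r 0.
Proof.
  intros hr. assert (hv := fneg r ltac:(lra)). unfold slope_ratio, Rpower.
  auto_derive.
  - assert (ef := ex_derive_profile r ltac:(lra)). assert (ep := ex_derive_slope r ltac:(lra)).
    repeat split; assumption || lra.
  - rewrite Derive_slope, Derive_profile by lra.
    set (E := exp _).
    transitivity (E / (r ^ 2 * (1 - f r)) * ((r * p1 r - p r) * (1 - f r) -
      - (1 + 1 / m) * r * p r ^ 2)); [field; lra|].
    rewrite slope_ode by assumption. ring.
Qed.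

Lemma slope_ratio_const (r s : R) : 0 < r < 1 -> 0 < s < 1 -> slope_ratio r = slope_ratio s.
Proof.
  assert (W : forall a b, 0 < a -> a < b -> b < 1 -> slope_ratio a = slope_ratio b).
  { intros a b ha hab hb. apply (eq_is_derive slope_ratio a b); [|assumption].
    intros t ht. apply is_derive_slope_ratio. lra. }
  intros hr hs. destruct (Rtotal_order r s) as [h|[->|h]].
  - apply W; lra.
  - reflexivity.
  - symmetry. apply W; lra.
Qed.

(** The value of [slope_ratio] is kept alongside the affine form so that p can later be recovered
    algebraically, without differentiating the profile. *)
Lemma power_profile_affine : exists A B, 0 < A /\ 0 < B /\
  (forall r, 0 <= r < 1 -> Rpower (1 - f r) (- (1 / m)) = A + B * r ^ 2) /\
  (forall r, 0 < r < 1 -> slope_ratio r = 2 * m * B).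
Proof.
  set (h := slope_ratio (1 / 2)).
  assert (hh : 0 < h).
  { assert (g := slope_pos (1 / 2) ltac:(lra)).
    apply Rmult_lt_0_compat; [lra|apply exp_pos]. }
  exists (Rpower (1 - f 0) (- (1 / m))), (h / (2 * m)). split; [apply exp_pos|].
  split; [apply Rdiv_lt_0_compat; lra|].
  split.
  2: { intros r hr. rewrite (slope_ratio_const r (1 / 2)) by lra. fold h. field. lra. }
  intros r [[hr|<-] hr1]; [|ring].
  set (G := fun r => Rpower (1 - f r) (- (1 / m)) - h / (2 * m) * r ^ 2).
  destruct (mvt_open G (fun _ => 0) 0 r) as (c & hc & E).
  { assumption. }
  { intros x hx. assert (hv := fneg x ltac:(lra)).
    assert (hx1 : h = slope_ratio x) by (apply slope_ratio_const; lra).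
    unfold G, Rpower. auto_derive.
    - split; [eexists; apply df; lra|]. split; [lra|trivial].
    - rewrite Derive_profile, hx1 by lra. unfold slope_ratio.
      replace (- (1 + 1 / m)) with (- (1 / m) - 1) by ring.
      rewrite Rpower_minus_1 by lra. unfold Rpower.
      change (1 + - f x) with (1 - f x). field. lra. }
  { intros x hx. assert (hv := fneg x ltac:(lra)).
    apply ex_derive_continuity_pt.
    unfold G, Rpower. auto_derive.
    split; [eexists; apply df; lra|]. split; [lra|trivial]. }
  unfold G in E. lra.
Qed.

Lemma radial_profile_bubble : exists d, 0 < d /\ root_eq n k lam d /\
  forall r, 0 <= r < 1 -> f r = 1 - Rpower ((1 + d) / (1 + d * r ^ 2)) m.
Proof.
  destruct power_profile_affine as (A & B & hA & hB & hG & hS).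
  assert (hf : forall r, 0 <= r < 1 -> 1 - f r = Rpower (A + B * r ^ 2) (- m)).
  { intros r hr. assert (hv := fneg r hr). rewrite <- hG by assumption.
    rewrite Rpower_mult. replace (- (1 / m) * - m) with 1 by (field; lra).
    rewrite Rpower_1; lra. }
  (* f is only known to tend to 0 as r increases to 1, while the closed form w is continuous at 1.
     If w 1 were nonzero, some 1 - e would have both |f| and |f - w 1| below |w 1| / 2. *)
  assert (hAB : A + B = 1).
  { assert (cw : continuity_pt (fun r => 1 - Rpower (A + B * r ^ 2) (- m)) 1).
    { apply ex_derive_continuity_pt.
      unfold Rpower. auto_derive. lra. }
    destruct (Req_dec (1 - Rpower (A + B * 1 ^ 2) (- m)) 0) as [E|NE].
    - assert (L : ln (Rpower (A + B * 1 ^ 2) (- m)) = ln 1) by (f_equal; lra).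
      rewrite ln_Rpower, ln_1 in L. apply Rmult_integral in L.
      destruct L as [L|L]; [lra|]. rewrite <- ln_1 in L.
      apply ln_inv in L; lra.
    - exfalso. set (w := fun r => 1 - Rpower (A + B * r ^ 2) (- m)) in *.
      assert (hpos : 0 < Rabs (w 1) / 2) by (assert (g := Rabs_pos_lt _ NE); unfold w; lra).
      destruct (f1 _ hpos) as (d1 & hd1 & h1).
      destruct (cw _ hpos) as (d2 & hd2 & h2).
      set (e := Rmin (Rmin d1 d2) 1 / 2).
      assert (he : 0 < e /\ e < d1 /\ e < d2 /\ e < 1).
      { unfold e. assert (g1 := Rmin_l (Rmin d1 d2) 1). assert (g2 := Rmin_r (Rmin d1 d2) 1).
        assert (g3 := Rmin_l d1 d2). assert (g4 := Rmin_r d1 d2).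
        assert (0 < Rmin (Rmin d1 d2) 1) by (repeat apply Rmin_glb_lt; lra).
        lra. }
      specialize (h1 (1 - e) ltac:(lra) ltac:(lra)).
      specialize (h2 (1 - e)). simpl in h2. unfold R_dist, D_x, no_cond in h2.
      assert (h3 : Rabs (w (1 - e) - w 1) < Rabs (w 1) / 2).
      { apply h2. split; [split; [trivial|lra]|]. apply Rabs_def1; lra. }
      assert (E : f (1 - e) = w (1 - e)).
      { unfold w. rewrite <- hf by lra. ring. }
      rewrite E in h1.
      assert (g := Rabs_triang (w (1 - e)) (- (w (1 - e) - w 1))).
      rewrite Rabs_Ropp in g.
      replace (w (1 - e) + - (w (1 - e) - w 1)) with (w 1) in g by ring. lra. }
  (* With A + B = 1 this gives A = 1 / (1+d), hence A + B r^2 = (1 + d r^2) / (1+d). *)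
  set (d := B / A).
  assert (hd : 0 < d) by (apply Rdiv_lt_0_compat; assumption).
  assert (hX : forall r, 0 <= r < 1 ->
    1 - f r = Rpower ((1 + d) / (1 + d * r ^ 2)) m).
  { intros r hr. rewrite hf by assumption.
    assert (0 <= d * r ^ 2) by (apply Rmult_le_pos; [lra|apply pow2_ge_0]).
    replace ((1 + d) / (1 + d * r ^ 2)) with (/ (A + B * r ^ 2)).
    - unfold Rpower. rewrite ln_Rinv; [f_equal; ring|].
      assert (0 <= B * r ^ 2) by (apply Rmult_le_pos; [lra|apply pow2_ge_0]). lra.
    - assert (0 <= B * r ^ 2) by (apply Rmult_le_pos; [lra|apply pow2_ge_0]).
      replace (1 + d) with (/ A) by (unfold d; field_simplify; [|lra..]; f_equal; lra).
      unfold d. field. lra. }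
  exists d. split; [assumption|]. split.
  2: { intros r hr. specialize (hX r hr). lra. }
  (* Any interior radius would do, because the root equation does not involve r. The Pohozaev
     identity contains p but not p', so the formulas for v and p suffice. *)
  set (r := 1 / 2). assert (hr : 0 < r < 1) by (unfold r; lra).
  assert (hr2 : 0 < r ^ 2) by (apply pow_lt; lra). clearbody r.
  assert (hBr : 0 < B * r ^ 2) by (apply Rmult_lt_0_compat; lra).
  assert (hdr : 0 < 1 + d * r ^ 2)
    by (apply Rplus_lt_0_compat; [lra|apply Rmult_lt_0_compat; lra]).
  assert (hv := fneg r ltac:(lra)).
  assert (hp : p r / r = 2 * m * d * (1 - f r) / (1 + d * r ^ 2)).
  { assert (S := hS r hr). unfold slope_ratio in S.
    replace (- (1 + 1 / m)) with (- (1 / m) - 1) in S by ring.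
    rewrite Rpower_minus_1, hG in S by lra.
    apply (Rmult_eq_reg_r ((A + B * r ^ 2) / (1 - f r))).
    2: { apply Rgt_not_eq, Rdiv_lt_0_compat; lra. }
    replace (p r / r * ((A + B * r ^ 2) / (1 - f r))) with (2 * m * B)
      by (rewrite <- S; reflexivity).
    unfold d. field. repeat split; lra. }
  assert (P := pohozaev_zero r hr). unfold pohozaev in P.
  rewrite Rpower_plus, Rpower_1 in P by lra.
  (* From m q = k m + (k+1): the real power splits into integer powers, and the exponent k+1 of the
     root equation appears. *)
  assert (hV : Rpower (1 - f r) q = (1 - f r) ^ k * ((1 + d) / (1 + d * r ^ 2)) ^ (k + 1)).
  { rewrite hX by lra. set (Y := (1 + d) / (1 + d * r ^ 2)).
    assert (0 < Y) by (apply Rdiv_lt_0_compat; lra).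
    rewrite <- (Rpower_pow k), <- (Rpower_pow (k + 1)), !Rpower_mult, <- Rpower_plus
      by (assumption || apply exp_pos).
    f_equal. rewrite plus_INR. unfold qstar, bexp. simpl (INR 1). field. lra. }
  assert (hC := C_pos n k).
  replace (p r) with (r * (2 * m * d * (1 - f r) / (1 + d * r ^ 2))) in P
    by (rewrite <- hp; field; lra).
  rewrite hV in P.
  replace (r ^ n) with (r ^ (n - k) * r ^ k) in P by (rewrite <- pow_add; f_equal; lia).
  unfold root_eq. rewrite <- (two_bexp n k hk hn).
  unfold Rdiv in P. rewrite !Rpow_mult_distr, !pow_inv in P.
  assert (0 < r ^ (n - k)) by (apply pow_lt; lra).
  assert (0 < r ^ k) by (apply pow_lt; lra).
  assert (0 < (1 - f r) ^ k) by (apply pow_lt; lra).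
  assert (hDk : 0 < (1 + d * r ^ 2) ^ k) by (apply pow_lt; lra).
  replace (k + 1)%nat with (S k) in * by lia.
  rewrite <- (tech_pow_Rmult (1 + d) k), <- (tech_pow_Rmult (1 + d * r ^ 2) k) in P.
  rewrite <- tech_pow_Rmult, (Rplus_comm d 1), Rpow_mult_distr.
  apply (Rmult_eq_reg_l (2 * m * (1 - f r) * r ^ (n - k) * r ^ k * (1 - f r) ^ k /
    (C n k * ((1 + d * r ^ 2) * (1 + d * r ^ 2) ^ k)))).
  2: { apply Rgt_not_eq, Rdiv_lt_0_compat;
         repeat first [assumption | lra | apply Rmult_lt_0_compat]. }
  rewrite Rmult_0_r, <- P. field. repeat split; lra.
Qed.
End RadialODE.

(** * From a radial function on the ball to its profile *)

Definition axis (n : nat) (r : R) : pt := fun j => r * delta (n - 1) j.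

Lemma shift_axis (n : nat) (r t : R) : shift (n - 1) t (axis n r) = axis n (r + t).
Proof.
  apply functional_extensionality. intros j. rewrite shift_delta. unfold axis. ring.
Qed.

Lemma norm2_axis (n : nat) (r : R) : (1 <= n)%nat -> norm2 n (axis n r) = r ^ 2.
Proof.
  intros hn. unfold norm2, axis.
  rewrite (rsum_ext _ _ (fun i => delta (n - 1) i * (r ^ 2 * delta (n - 1) i)))
    by (intros; ring).
  rewrite rsum_delta, delta_diag by lia. ring.
Qed.

Lemma in_Rn_axis (n : nat) (r : R) : (1 <= n)%nat -> in_Rn n (axis n r).
Proof. intros hn i hi. unfold axis. rewrite delta_off by lia. ring. Qed.

Lemma in_ball_axis (n : nat) (r : R) : (1 <= n)%nat -> -1 < r < 1 -> in_ball n (axis n r).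
Proof.
  intros hn hr. split; [now apply in_Rn_axis|]. rewrite norm2_axis by assumption. nra.
Qed.

Lemma in_cball_axis (n : nat) (r : R) : (1 <= n)%nat -> -1 <= r <= 1 -> in_cball n (axis n r).
Proof.
  intros hn hr. split; [now apply in_Rn_axis|]. rewrite norm2_axis by assumption. nra.
Qed.

Lemma ball_cball (n : nat) (x : pt) : in_ball n x -> in_cball n x.
Proof. intros [h1 h2]. split; [assumption|lra]. Qed.

Lemma is_derive_axis (n : nat) (g : pt -> R) (r l : R) :
  has_partial g (n - 1) (axis n r) l -> is_derive (fun s => g (axis n s)) r l.
Proof.
  intros h. apply is_derive_Reals. intros eps heps.
  destruct (h eps heps) as (d & hd). exists d. intros t ht htd.
  specialize (hd t ht htd). rewrite !shift_axis, Rplus_0_l, Rplus_0_r in hd. exact hd.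
Qed.

(** The radial formulas for u and its gradient are available only inside the ball, away from the
    origin for the gradient; this permits differentiating them locally. *)
Lemma shift_near_ball (n i : nat) (x : pt) : (i < n)%nat -> in_ball n x -> 0 < norm2 n x ->
  locally 0 (fun t => in_ball n (shift i t x) /\ 0 < norm2 n (shift i t x)).
Proof.
  intros hi [hx hx1] hx0.
  assert (c : continuous (fun t => norm2 n x + (2 * x i * t + t ^ 2)) 0).
  { apply (@ex_derive_continuous R_AbsRing R_NormedModule). auto_derive. trivial. }
  assert (L : locally (norm2 n x + (2 * x i * 0 + 0 ^ 2)) (fun z => 0 < z < 1)).
  { apply (open_and (fun z => 0 < z) (fun z => z < 1)); [apply open_gt|apply open_lt|].
    replace (norm2 n x + _) with (norm2 n x) by ring. lra. }
  apply (filter_imp (fun t => 0 < norm2 n x + (2 * x i * t + t ^ 2) < 1)).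
  - intros t ht. unfold in_ball. rewrite norm2_shift by assumption.
    repeat split; try lra. now apply in_Rn_shift.
  - apply (c _ L).
Qed.

Section Radial.
Variables (n : nat) (u : pt -> R) (D1 : nat -> pt -> R) (D2 : nat -> nat -> pt -> R).
Hypothesis (hn : (1 <= n)%nat) (C2 : is_C2_on_ball n u D1 D2) (hrad : radial n u).

Notation p r := (D1 (n - 1)%nat (axis n r)).
Notation p1 r := (D2 (n - 1)%nat (n - 1)%nat (axis n r)).

Lemma radial_eq_axis (x : pt) : in_cball n x -> u x = u (axis n (sqrt (norm2 n x))).
Proof.
  intros hx. assert (h := norm2_nonneg n x). destruct hx as [hx hx1].
  assert (hs := sqrt_sqrt _ h). assert (hs0 := sqrt_pos (norm2 n x)).
  apply hrad.
  - split; assumption.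
  - apply in_cball_axis; [assumption|]. nra.
  - rewrite norm2_axis by assumption. simpl. lra.
Qed.

Lemma is_derive_u_axis (r : R) : -1 < r < 1 -> is_derive (fun s => u (axis n s)) r (p r).
Proof.
  intros hr. apply is_derive_axis.
  destruct (C2 _ (in_ball_axis n r hn hr)) as [_ h].
  apply (h (n - 1)%nat ltac:(lia)).
Qed.

Lemma is_derive_slope_axis (r : R) : -1 < r < 1 -> is_derive (fun s => p s) r (p1 r).
Proof.
  intros hr. apply (is_derive_axis n (D1 (n - 1)%nat)).
  destruct (C2 _ (in_ball_axis n r hn hr)) as [_ h].
  apply (h (n - 1)%nat ltac:(lia)). lia.
Qed.

(** Along the signed axis the profile is even, so its derivative at 0 equals its own opposite. *)
Lemma slope_axis_0 : p 0 = 0.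
Proof.
  assert (D := is_derive_u_axis 0 ltac:(lra)).
  assert (D' : is_derive (fun s => u (axis n (- s))) 0 (- p 0)).
  { replace (- p 0) with (-1 * p 0) by ring.
    apply (is_derive_comp (fun s => u (axis n s)) Ropp 0).
    - rewrite Ropp_0. exact D.
    - auto_derive; trivial. }
  assert (D'' : is_derive (fun s => u (axis n s)) 0 (- p 0)).
  { refine (is_derive_ext_loc _ _ _ _ _ D').
    exists (mkposreal 1 Rlt_0_1). intros s hs.
    assert (hs' : Rabs (s - 0) < 1) by exact hs. apply Rabs_def2 in hs'.
    apply hrad; [apply in_cball_axis; [assumption|lra]..|].
    rewrite !norm2_axis by assumption. ring. }
  apply is_derive_unique in D. apply is_derive_unique in D''.
  rewrite D in D''. lra.
Qed.

Lemma norm_in_unit (x : pt) : in_ball n x -> 0 < norm2 n x -> 0 < sqrt (norm2 n x) < 1.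
Proof.
  intros [_ hx] h0. split; [now apply sqrt_lt_R0|].
  rewrite <- sqrt_1. apply sqrt_lt_1; lra.
Qed.

Lemma radial_gradient (x : pt) (i : nat) : (i < n)%nat -> in_ball n x -> 0 < norm2 n x ->
  D1 i x = p (sqrt (norm2 n x)) * x i / sqrt (norm2 n x).
Proof.
  intros hi hx hx0. assert (hr := norm_in_unit x hx hx0).
  destruct (C2 x hx) as [_ h]. destruct (h i hi) as [h1 _].
  apply is_derive_Reals, is_derive_unique in h1. rewrite <- h1.
  apply is_derive_unique.
  apply (is_derive_ext_loc (fun t => u (axis n (sqrt (norm2 n x + (2 * x i * t + t ^ 2)))))).
  { generalize (shift_near_ball n i x hi hx hx0). apply filter_imp. intros t [ht _].
    rewrite <- (norm2_shift n i t x hi). symmetry. apply radial_eq_axis, ball_cball, ht. }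
  replace (p (sqrt (norm2 n x)) * x i / sqrt (norm2 n x))
    with ((x i / sqrt (norm2 n x)) * p (sqrt (norm2 n x))) by (field; lra).
  apply (is_derive_comp (fun s => u (axis n s))
    (fun t => sqrt (norm2 n x + (2 * x i * t + t ^ 2))) 0).
  - replace (norm2 n x + _) with (norm2 n x) by ring. apply is_derive_u_axis. lra.
  - auto_derive.
    + replace (norm2 n x + _) with (norm2 n x) by ring. assumption.
    + replace (norm2 n x + _) with (norm2 n x) by ring. field. lra.
Qed.

(** The gradient formula holds at all nearby points, so it can be differentiated in x_j. The result
    is p/r on the tangential directions and p' on the radial one. *)
Lemma radial_hessian (x : pt) (i j : nat) : (i < n)%nat -> (j < n)%nat ->
  in_ball n x -> 0 < norm2 n x ->
  let r := sqrt (norm2 n x) in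
  D2 i j x = p r / r * delta i j + (p1 r - p r / r) / r ^ 2 * x i * x j.
Proof.
  intros hi hj hx hx0 r. assert (hr := norm_in_unit x hx hx0). fold r in hr.
  destruct (C2 x hx) as [_ h]. destruct (h i hi) as (_ & _ & h2).
  destruct (h2 j hj) as [h3 _].
  apply is_derive_Reals, is_derive_unique in h3. rewrite <- h3.
  apply is_derive_unique.
  set (P := fun s => p s).
  apply (is_derive_ext_loc (fun t => P (sqrt (norm2 n x + (2 * x j * t + t ^ 2))) *
    (x i + t * delta j i) / sqrt (norm2 n x + (2 * x j * t + t ^ 2)))).
  { generalize (shift_near_ball n j x hj hx hx0). apply filter_imp. intros t [ht ht0].
    rewrite radial_gradient by assumption.
    rewrite norm2_shift, shift_delta by assumption. reflexivity. }
  assert (DP : is_derive P r (p1 r)) by (apply is_derive_slope_axis; lra).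
  change (p r) with (P r). rewrite (delta_sym i j). clearbody P.
  assert (E : norm2 n x + (2 * x j * 0 + 0 ^ 2) = norm2 n x) by ring.
  assert (E' : norm2 n x + (2 * x j * 0 + 0 * (0 * 1)) = norm2 n x) by ring.
  auto_derive; rewrite ?E, ?E'; fold r.
  - repeat split; try lra. exists (p1 r). exact DP.
  - rewrite (is_derive_unique (fun s : R => P s) _ _ DP). field. lra.
Qed.

Lemma Sk_radial (k : nat) (r : R) : (1 <= k < n)%nat -> 0 < r < 1 ->
  Sk n k (fun a b => D2 a b (axis n r)) =
  C n k * (p r / r) ^ (k - 1) * (p r / r + INR k / INR n * (p1 r - p r / r)).
Proof.
  intros hk hr.
  assert (hs : sqrt (norm2 n (axis n r)) = r)
    by (rewrite norm2_axis by assumption; apply sqrt_pow2; lra).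
  rewrite (Sk_rank1 n k (p r / r) ((p1 r - p r / r) / r ^ 2) (axis n r)).
  - rewrite norm2_axis by assumption. f_equal. f_equal. f_equal. field. lra.
  - assumption.
  - intros i j hi hj. rewrite radial_hessian; try assumption.
    + now rewrite hs.
    + apply in_ball_axis; [assumption|lra].
    + rewrite norm2_axis by assumption. apply pow_lt. lra.
Qed.
End Radial.

(** * Classification of the radial solutions *)

Lemma dist2_axis (n : nat) (r s : R) : (1 <= n)%nat ->
  dist2 n (axis n r) (axis n s) = (r - s) ^ 2.
Proof.
  intros hn. rewrite <- (norm2_axis n (r - s)) by assumption.
  apply rsum_ext. intros i _. unfold axis. f_equal. ring.
Qed.

Lemma radial_solution_bubble (n k : nat) (lam : R) (u : pt -> R) :
  (1 <= k)%nat -> (2 * k < n)%nat -> 0 < lam ->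
  is_solution n k lam u -> radial n u ->
  exists d, 0 < d /\ root_eq n k lam d /\ forall x, in_cball n x -> u x = bubble n k d x.
Proof.
  intros hk hn hl (D1 & D2 & C2 & hc & hS & h0) hrad.
  assert (hn1 : (1 <= n)%nat) by lia.
  destruct (INR_bounds n k hk hn) as [Kk Kn].
  destruct (radial_profile_bubble n k lam (fun r => u (axis n r))
    (fun r => D1 (n - 1)%nat (axis n r))
    (fun r => D2 (n - 1)%nat (n - 1)%nat (axis n r)) hk hn hl)
    as (d & hd & hroot & hf).
  - intros r hr. now apply is_derive_u_axis with (D2 := D2).
  - intros r hr. now apply (is_derive_slope_axis n u D1 D2).
  - now apply (slope_axis_0 n u D1 D2).
  - intros r hr. apply hS, in_ball_axis; [assumption|lra].
  - intros r hr. rewrite <- (Sk_radial n u D1 D2 hn1 C2 hrad k r ltac:(lia) hr).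
    apply hS, in_ball_axis; [assumption|lra].
  - intros r hr.
    destruct (hS (axis n r) (in_ball_axis n r hn1 ltac:(lra))) as [S1 _].
    specialize (S1 1%nat ltac:(lia)).
    rewrite (Sk_radial n u D1 D2 hn1 C2 hrad 1 r ltac:(lia) hr) in S1.
    simpl (_ ^ _) in S1. rewrite Rmult_1_r in S1. change (INR 1) with 1 in S1.
    assert (hC := C_pos n 1). nra.
  - intros eps heps.
    destruct (hc (axis n 1) (in_cball_axis n 1 hn1 ltac:(lra)) eps heps) as (e & he & H).
    exists e. split; [assumption|]. intros r hr hre.
    specialize (H (axis n r) (in_cball_axis n r hn1 ltac:(lra))).
    rewrite dist2_axis in H by assumption.
    rewrite (h0 (axis n 1)), Rminus_0_r in H.
    + apply H. nra.
    + split; [now apply in_Rn_axis|]. rewrite norm2_axis by assumption. ring.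
  - exists d. split; [assumption|]. split; [assumption|].
    (* The profile formula covers r < 1; on the sphere both functions vanish. *)
    intros x hx. destruct (Req_dec (norm2 n x) 1) as [e|ne].
    + rewrite (h0 x) by (split; [apply hx|assumption]).
      symmetry. now apply bubble_sphere.
    + assert (hnn := norm2_nonneg n x).
      rewrite (radial_eq_axis n u hn1 hrad x hx), hf.
      * unfold bubble. rewrite pow2_sqrt by assumption. reflexivity.
      * split; [apply sqrt_pos|]. rewrite <- sqrt_1.
        destruct hx. apply sqrt_lt_1; lra.
Qed.

Lemma radial_bubble (n k : nat) (d : R) : radial n (bubble n k d).
Proof. intros x y _ _ E. unfold bubble. now rewrite E. Qed.

Theorem theorem2 (n k : nat) (hk : (1 <= k)%nat) (hn : (2 * k < n)%nat) :
  (forall lam, 0 < lam < mustar n k ->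
     exists dm dp, 0 < dm < dp /\
       root_eq n k lam dm /\ root_eq n k lam dp /\
       (forall d, 0 < d -> root_eq n k lam d -> d = dm \/ d = dp) /\
       is_solution n k lam (sol_from n k lam dm) /\ radial n (sol_from n k lam dm) /\
       is_solution n k lam (sol_from n k lam dp) /\ radial n (sol_from n k lam dp) /\
       (exists x, in_ball n x /\ sol_from n k lam dm x <> sol_from n k lam dp x) /\
       (forall u, is_solution n k lam u -> radial n u ->
          (forall x, in_cball n x -> u x = sol_from n k lam dm x) \/
          (forall x, in_cball n x -> u x = sol_from n k lam dp x)))
  /\
  (is_solution n k (mustar n k) (ustar n k) /\ radial n (ustar n k) /\
   (forall x, in_cball n x -> ustar n k x = sol_from n k (mustar n k) (INR k) x) /\
   (forall u, is_solution n k (mustar n k) u -> radial n u ->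
      forall x, in_cball n x -> u x = ustar n k x)).
Proof.
  destruct (INR_bounds n k hk hn) as [Kk Kn].
  set (K := C n k * ((INR n - 2 * INR k) / INR k) ^ k).
  assert (hK : 0 < K).
  { apply Rmult_lt_0_compat; [apply C_pos|]. apply pow_lt, Rdiv_lt_0_compat; lra. }
  split.
  - intros lam hlam.
    (* For this [K], [mustar] is by conversion the peak value K k^k / (k+1)^(k+1). *)
    destruct (two_roots k K hk hK lam hlam) as (dm & dp & hd & hm & hp & huniq).
    assert (E : forall d, 0 < d -> root_eq n k lam d ->
      sol_from n k lam d = bubble n k d).
    { intros d hd0 hr. apply functional_extensionality. intros x.
      apply sol_from_bubble; tauto. }
    exists dm, dp. rewrite (E dm), (E dp) by (assumption || lra).
    do 4 (split; [assumption|]).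
    do 2 (split; [apply bubble_solution; assumption || lra|split; [apply radial_bubble|]]).
    split.
    (* At the centre a bubble takes the value 1 - (1+d)^m, which is strictly monotone in d. *)
    + exists (axis n 0). split; [apply in_ball_axis; [lia|lra]|].
      unfold bubble. rewrite norm2_axis by lia.
      assert (g : Rpower ((1 + dm) / (1 + dm * 0 ^ 2)) (bexp n k) <
                  Rpower ((1 + dp) / (1 + dp * 0 ^ 2)) (bexp n k)); [|lra].
      apply Rlt_Rpower_l; [now apply bexp_pos|].
      replace (1 + dm * 0 ^ 2) with 1 by ring. replace (1 + dp * 0 ^ 2) with 1 by ring.
      lra.
    + intros u hu hrad.
      destruct (radial_solution_bubble n k lam u hk hn ltac:(lra) hu hrad)
        as (d & hd0 & hr & hub).
      destruct (huniq d hd0 hr) as [->| ->]; auto.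
  - assert (hmu : 0 < mustar n k).
    { apply Rdiv_lt_0_compat; [|apply pow_lt; lra].
      apply Rmult_lt_0_compat; [assumption|apply pow_lt; lra]. }
    assert (hroot : root_eq n k (mustar n k) (INR k)).
    { unfold root_eq, mustar. fold K. field. apply pow_nonzero. lra. }
    change (ustar n k) with (bubble n k (INR k)).
    split; [apply bubble_solution; assumption || lra|].
    split; [apply radial_bubble|]. split.
    + intros x _. symmetry. apply sol_from_bubble; assumption || lra.
    + intros u hu hrad.
      destruct (radial_solution_bubble n k _ u hk hn hmu hu hrad) as (d & hd0 & hr & hub).
      replace (INR k) with d; [exact hub|].
      exact (root_peak k K hk hK d hd0 hr).
Qed.
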